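(* Let $G$ be a finite abelian group, $I\subset D\subset G$ subgroups with $D/I$ cyclic, $\varphi$ a generator of $D/I$, and $A=\mathbb{Z}[G/I]/(g)$ with $g=1-\varphi^{-1}+\#I$. Let $I=I_1\times\cdots\times I_s$ be any decomposition into cyclic subgroups (some possibly trivial), and let $\mathcal{J}$ be the ideal defined below. Then \[ h\,\mathrm{Fitt}^{[1]}_{\mathbb{Z}[G]}(A)=\Bigl(\nu_I,\ \bigl(1-\tfrac{\nu_I}{\#I}\varphi^{-1}\bigr)\mathcal{J}\Bigr) \] as fractional ideals of $\mathbb{Z}[G]$.
   Context: $\nu_I=\sum_{\tau\in I}\tau$; $h=1-\frac{\nu_I}{\#I}\varphi^{-1}+\nu_I\in\mathbb{Q}[G]$, where $\nu_I\varphi^{-1}$ means $\nu_I\tilde\varphi^{-1}$ for any lift $\tilde\varphi\in D$ of $\varphi$ (independent of the lift); $g\in\mathbb{Z}[G/I]$ and $h$ are non-zero-divisors. For $1\le l\le s$ put $\nu_l=\sum_{\sigma\in I_l}\sigma$. For $0\le i\le s$, $Z_i$ is the ideal of $\mathbb{Z}[G]$ generated by all products $\nu_{l_1}\cdots\nu_{l_{s-i}}$ with $1\le l_1<\cdots<l_{s-i}\le s$ (so $Z_s=(1)$). $\mathcal{I}_D=\mathrm{Ker}(\mathbb{Z}[G]\to\mathbb{Z}[G/D])$, and $\mathcal{J}=\sum_{i=1}^s Z_i\mathcal{I}_D^{i-1}$. For a finite $\mathbb{Z}[G]$-module $X$, $\mathrm{Fitt}^{[1]}_{\mathbb{Z}[G]}(X)=\mathrm{Fitt}_{\mathbb{Z}[G]}(P)^{-1}\mathrm{Fitt}_{\mathbb{Z}[G]}(Y)$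 for any exact sequence $0\to Y\to P\to X\to0$ of finite $\mathbb{Z}[G]$-modules with $\mathrm{pd}_{\mathbb{Z}[G]}P\le1$ (independent of choice; $\mathrm{Fitt}(P)$ is generated by a non-zero-divisor). Fractional ideals are finitely generated $\mathbb{Z}[G]$-submodules of $\mathbb{Q}[G]$. *)

(* Defs.v *)
From HB Require Import structures.
From mathcomp Require Import all_boot all_algebra all_fingroup all_solvable.
From mathcomp Require Import generic_quotient ring_quotient.
From mathcomp Require Import boolp classical_sets cardinality.

Set Implicit Arguments.
Unset Strict Implicit.
Unset Printing Implicit Defensive.

Import GRing.Theory.
Local Open Scope classical_set_scope.
Local Open Scope ring_scope.

HB.mixin Record isAbelianGroup T of FinGroup T := {
  mulgC_subproof : forall x y : T, (x * y = y * x)%g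
}.

#[short(type="finAbGroupType")]
HB.structure Definition FinAbGroup := {T of FinGroup T & isAbelianGroup T}.

Lemma abgC (G : finAbGroupType) (x y : G) : (x * y = y * x)%g.
Proof. exact: mulgC_subproof. Qed.

Lemma abg_norm (G : finAbGroupType) (A : {set G}) (x : G) : x \in 'N(A)%g.
Proof.
apply: (fintype.subsetP (cent_sub A)); apply/centP => y _; exact: abgC.
Qed.

Section QuotientAb.
Variables (G : finAbGroupType) (A : {set G}).

Lemma coset_abC (x y : coset_of A) : (x * y = y * x)%g.
Proof.
have [a aN ->] := cosetP x; have [b bN ->] := cosetP y.
by rewrite -!morphM // abgC.
Qed.

HB.instance Definition _ := isAbelianGroup.Build (coset_of A) coset_abC.
End QuotientAb.

(* The group ring R[G]: an element is its function of coefficients.  The alias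
   hides the pointwise product of {ffun G -> R}. *)
Definition gring (R : comNzRingType) (G : finAbGroupType) : Type :=
  {ffun G -> R}.

Section GroupRing.
Variables (R : comNzRingType) (G : finAbGroupType).
Local Notation RG := (gring R G).

HB.instance Definition _ := GRing.Zmodule.on RG.

Definition gcoef (a : RG) (x : G) : R := (a : {ffun G -> R}) x.

Definition gelt (x : G) : RG := [ffun y => (y == x)%:R].

Definition gring_mul (a b : RG) : RG :=
  [ffun x => \sum_y gcoef a y * gcoef b (y^-1 * x)%g].

Lemma gringP (a b : RG) : gcoef a =1 gcoef b -> a = b.
Proof. by move=> ab; apply/ffunP. Qed.

Lemma gcoefD (a b : RG) x : gcoef (a + b) x = gcoef a x + gcoef b x.
Proof. by rewrite /gcoef ffunE. Qed.

Lemma gcoefM (a b : RG) x :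
  gcoef (gring_mul a b) x = \sum_y gcoef a y * gcoef b (y^-1 * x)%g.
Proof. by rewrite /gcoef ffunE. Qed.

Lemma gcoef_elt x y : gcoef (gelt x) y = (y == x)%:R.
Proof. by rewrite /gcoef ffunE. Qed.

Lemma gring_mulC : commutative gring_mul.
Proof.
move=> a b; apply: gringP => x; rewrite !gcoefM.
rewrite [LHS](reindex_inj invg_inj) [LHS](reindex_inj (mulIg x^-1%g)) /=.
apply: eq_bigr => y _.
by rewrite invgK mulgKV invMg invgK (abgC x) mulrC.
Qed.

Lemma gring_mulA : associative gring_mul.
Proof.
move=> a b c; apply: gringP => x; rewrite !gcoefM.
under [RHS]eq_bigr => y _ do rewrite gcoefM mulr_suml.
rewrite exchange_big /=; apply: eq_bigr => z _.
rewrite gcoefM mulr_sumr (reindex_inj (mulgI z^-1%g)) /=.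
apply: eq_bigr => y _.
by rewrite invMg invgK mulrA mulgA mulgK.
Qed.

Lemma gring_mul1 : left_id (gelt 1%g) gring_mul.
Proof.
move=> a; apply: gringP => x; rewrite gcoefM (bigD1 1%g) //= big1 => [|y ny].
  by rewrite gcoef_elt eqxx mul1r addr0 invg1 mul1g.
by rewrite gcoef_elt (negbTE ny) mul0r.
Qed.

Lemma gring_mulDl : left_distributive gring_mul +%R.
Proof.
move=> a b c; apply: gringP => x; rewrite gcoefD !gcoefM -big_split.
by apply: eq_bigr => y _; rewrite gcoefD mulrDl.
Qed.

Lemma gring_1_neq0 : gelt 1%g != 0.
Proof.
apply/eqP => /(congr1 (gcoef^~ 1%g)).
rewrite gcoef_elt eqxx /gcoef ffunE; apply/eqP; exact: oner_neq0.
Qed.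

HB.instance Definition _ := GRing.Zmodule_isComNzRing.Build RG
  gring_mulA gring_mulC gring_mul1 gring_mulDl gring_1_neq0.

Definition gconst (c : R) : RG := [ffun y => if y == 1%g then c else 0].

Definition gsum (H : {set G}) : RG := \sum_(x in H) gelt x.

End GroupRing.

Section Projection.
Variables (R : comNzRingType) (G : finAbGroupType) (H : {group G}).

(* R[G] -> R[G/H] *)
Definition gproj (a : gring R G) : gring R (coset_of H) :=
  [ffun y => \sum_(x | coset H x == y) gcoef a x].

Lemma gprojE a y : gcoef (gproj a) y = \sum_(x | coset H x == y) gcoef a x.
Proof. by rewrite /gcoef ffunE. Qed.

Lemma gproj_is_zmod_morphism : zmod_morphism gproj.
Proof.
move=> a b; apply/ffunP => y; rewrite !ffunE -sumrB; apply: eq_bigr => x _.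
by rewrite /gcoef !ffunE.
Qed.

Lemma gproj_is_monoid_morphism : monoid_morphism gproj.
Proof.
split.
  apply: gringP => y; rewrite gprojE gcoef_elt.
  under eq_bigr => x _ do rewrite gcoef_elt.
  rewrite big_mkcond (bigD1 1%g) //= big1 => [|x nx]; last first.
    by rewrite (negbTE nx); case: ifP.
  by rewrite eqxx addr0 (morph1 (coset H)) eq_sym; case: ifP.
move=> a b; apply: gringP => z; rewrite gprojE gcoefM.
under eq_bigr => x _ do rewrite gcoefM.
rewrite exchange_big /= (partition_big (coset H) predT) //=.
apply: eq_bigr => w _; rewrite gprojE mulr_suml; apply: eq_bigr => y /eqP yw.
rewrite -mulr_sumr gprojE; congr (_ * _).
rewrite (reindex_inj (mulgI y)) /=; apply: eq_big => [x|x _].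
  by rewrite morphM ?abg_norm // -yw -(inj_eq (mulgI (coset H y)^-1%g)) mulKg.
by rewrite mulKg.
Qed.

HB.instance Definition _ := GRing.isZmodMorphism.Build _ _ gproj
  gproj_is_zmod_morphism.
HB.instance Definition _ := GRing.isMonoidMorphism.Build _ _ gproj
  gproj_is_monoid_morphism.

End Projection.

Section RationalGroupRing.
Variable G : finAbGroupType.
Local Notation ZG := (gring int G).
Local Notation QG := (gring rat G).

Definition gratr (a : ZG) : QG := [ffun x => (gcoef a x)%:~R].

Lemma gratrE a x : gcoef (gratr a) x = (gcoef a x)%:~R.
Proof. by rewrite /gcoef ffunE. Qed.

Lemma gratr_is_zmod_morphism : zmod_morphism gratr.
Proof. by move=> a b; apply/ffunP => x; rewrite !ffunE /gcoef !ffunE rmorphB. Qed.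

Lemma gratr_is_monoid_morphism : monoid_morphism gratr.
Proof.
split; first by apply: gringP => x; rewrite gratrE !gcoef_elt; case: eqP.
move=> a b; apply: gringP => x; rewrite gratrE !gcoefM rmorph_sum.
by apply: eq_bigr => y _; rewrite rmorphM !gratrE.
Qed.

HB.instance Definition _ := GRing.isZmodMorphism.Build _ _ gratr
  gratr_is_zmod_morphism.
HB.instance Definition _ := GRing.isMonoidMorphism.Build _ _ gratr
  gratr_is_monoid_morphism.

Definition gratr_scale (a : ZG) (x : QG) : QG := gratr a * x.

Lemma gratr_scaleA a b x :
  gratr_scale a (gratr_scale b x) = gratr_scale (a * b) x.
Proof. by rewrite /gratr_scale rmorphM mulrA. Qed.
Lemma gratr_scale1 : left_id 1 gratr_scale.
Proof. by move=> x; rewrite /gratr_scale rmorph1 mul1r. Qed.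
Lemma gratr_scaleDr : right_distributive gratr_scale +%R.
Proof. by move=> a x y; rewrite /gratr_scale mulrDr. Qed.
Lemma gratr_scaleDl x : {morph gratr_scale^~ x : a b / a + b}.
Proof. by move=> a b; rewrite /gratr_scale rmorphD mulrDl. Qed.

HB.instance Definition _ := GRing.Zmodule_isLmodule.Build ZG QG
  gratr_scaleA gratr_scale1 gratr_scaleDr gratr_scaleDl.

End RationalGroupRing.

Section Span.
Variables (R : comNzRingType) (M : lmodType R).

Definition lspan (S : set M) : set M :=
  [set x | exists n (a : 'I_n -> R) (v : 'I_n -> M),
     (forall i, S (v i)) /\ x = \sum_i a i *: v i].

Definition lspanb (S : set M) : {pred M} := fun x => `[< lspan S x >].

Lemma lspanb_closed S : zmod_closed (lspanb S).
Proof.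
split; first by apply/asboolP; exists 0%N, (fun=> 0), (fun=> 0); split;
  [case | rewrite big_ord0].
move=> x y /asboolP[m [a [v [Sv ->]]]] /asboolP[n [b [w [Sw ->]]]].
apply/asboolP; exists (m + n)%N.
exists (fun i => match split i with inl j => a j | inr j => - b j end).
exists (fun i => match split i with inl j => v j | inr j => w j end).
split=> [i|]; first by case: split.
rewrite big_split_ord -sumrN /=; congr (_ + _); apply: eq_bigr => i _.
  by rewrite (unsplitK (inl i)).
by rewrite (unsplitK (inr i)) scaleNr.
Qed.

Lemma lspanbZ S a x : x \in lspanb S -> a *: x \in lspanb S.
Proof.
move=> /asboolP[n [b [v [Sv ->]]]]; apply/asboolP.
exists n, (fun i => a * b i), v; split=> //.
by rewrite scaler_sumr; apply: eq_bigr => i _; rewrite scalerA.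
Qed.

HB.instance Definition _ S := GRing.isZmodClosed.Build M (lspanb S)
  (lspanb_closed S).

(* The quotient of M by the submodule generated by S. *)
Definition lquot (S : set M) : Type := @Quotient.quot M (lspanb S).

Section QuotientModule.
Variable S : set M.
Local Notation Q := (lquot S).

HB.instance Definition _ := GRing.Zmodule.on Q.

Definition lquot_pi (x : M) : Q := \pi_(@Quotient.quot M (lspanb S))%qT x.

Definition lquot_scale (a : R) (u : Q) : Q :=
  lquot_pi (a *: repr (u : @Quotient.quot M (lspanb S))).

Lemma lquot_piD x y : lquot_pi (x + y) = lquot_pi x + lquot_pi y.
Proof. exact: raddfD. Qed.

Lemma lquot_pi_surj u : exists x, u = lquot_pi x.
Proof. by exists (repr (u : @Quotient.quot M (lspanb S))); rewrite /lquot_pi reprK. Qed.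

Lemma lquot_piZ a x : lquot_scale a (lquot_pi x) = lquot_pi (a *: x).
Proof.
apply/eqP; rewrite /lquot_scale /lquot_pi -Quotient.idealrBE -scalerBr.
by rewrite lspanbZ // Quotient.idealrBE reprK.
Qed.

Lemma lquot_scaleA a b u :
  lquot_scale a (lquot_scale b u) = lquot_scale (a * b) u.
Proof. by have [x ->] := lquot_pi_surj u; rewrite !lquot_piZ scalerA. Qed.
Lemma lquot_scale1 : left_id 1 lquot_scale.
Proof. by move=> u; have [x ->] := lquot_pi_surj u; rewrite lquot_piZ scale1r. Qed.
Lemma lquot_scaleDr : right_distributive lquot_scale +%R.
Proof.
move=> a u v; have [x ->] := lquot_pi_surj u; have [y ->] := lquot_pi_surj v.
by rewrite -lquot_piD !lquot_piZ scalerDr lquot_piD.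
Qed.
Lemma lquot_scaleDl u : {morph lquot_scale^~ u : a b / a + b}.
Proof.
move=> a b; have [x ->] := lquot_pi_surj u.
by rewrite !lquot_piZ scalerDl lquot_piD.
Qed.

HB.instance Definition _ := GRing.Zmodule_isLmodule.Build R Q
  lquot_scaleA lquot_scale1 lquot_scaleDr lquot_scaleDl.

End QuotientModule.
End Span.

(* Restriction of scalars of M along f. *)
Definition restr (R S : comNzRingType) (f : {rmorphism R -> S})
  (M : lmodType S) : Type := M.

Section Restriction.
Variables (R S : comNzRingType) (f : {rmorphism R -> S}) (M : lmodType S).
Local Notation N := (restr f M).

HB.instance Definition _ := GRing.Zmodule.on N.

Definition restr_scale (a : R) (x : N) : N := f a *: (x : M).

Lemma restr_scaleA a b x :
  restr_scale a (restr_scale b x) = restr_scale (a * b) x.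
Proof. by rewrite /restr_scale rmorphM scalerA. Qed.
Lemma restr_scale1 : left_id 1 restr_scale.
Proof. by move=> x; rewrite /restr_scale rmorph1 scale1r. Qed.
Lemma restr_scaleDr : right_distributive restr_scale +%R.
Proof. by move=> a x y; rewrite /restr_scale scalerDr. Qed.
Lemma restr_scaleDl x : {morph restr_scale^~ x : a b / a + b}.
Proof. by move=> a b; rewrite /restr_scale rmorphD scalerDl. Qed.

HB.instance Definition _ := GRing.Zmodule_isLmodule.Build R N
  restr_scaleA restr_scale1 restr_scaleDr restr_scaleDl.

End Restriction.

Section Ideals.
Variable R : comNzRingType.

Definition ideal_gen (S : set R) : set R := @lspan R R^o S.

(* R/(g) as an R-module *)
Definition cyc_quot (g : R) : lmodType R := lquot ([set g] : set R^o).

Definition idealM (A B : set R) : set R :=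
  ideal_gen [set x | exists a b, [/\ A a, B b & x = a * b]].

Definition idealX (A : set R) (n : nat) : set R := iter n (idealM A) setT.

End Ideals.

Section Modules.
Variable R : comNzRingType.

Definition projective (M : lmodType R) : Prop :=
  forall (N N' : lmodType R) (p : {linear N -> N'}) (f : {linear M -> N'}),
    (forall y, exists x, p x = y) -> exists g : {linear M -> N}, p \o g =1 f.

Definition short_exact (M' M M'' : lmodType R)
    (i : {linear M' -> M}) (p : {linear M -> M''}) : Prop :=
  [/\ injective i, (forall z, exists y, p y = z)
    & forall y, p y = 0 <-> exists x, i x = y].

Definition pd_le1 (M : lmodType R) : Prop :=
  exists (F1 F0 : lmodType R) (d : {linear F1 -> F0}) (e : {linear F0 -> M}),
    [/\ projective F1, projective F0 & short_exact d e].

(* Generated by the maximal minors of the relations between the generators x. *)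
Definition fitt_of (M : lmodType R) (n : nat) (x : 'I_n -> M) : set R :=
  ideal_gen [set d | exists B : 'M[R]_n,
    (forall i, \sum_j B i j *: x j = 0) /\ d = \det B].

(* The Fitting ideal does not depend on the finite generating family; it is
   computed from an arbitrary one (set0 if M is not finitely generated). *)
Definition Fitt (M : lmodType R) : set R :=
  xget set0 [set J | exists n (x : 'I_n -> M),
    lspan (range x) = setT /\ J = fitt_of x].

End Modules.

Section FractionalIdeals.
Variable G : finAbGroupType.
Local Notation ZG := (gring int G).
Local Notation QG := (gring rat G).

(* The Z[G]-submodule of Q[G] generated by S. *)
Definition frac_gen (S : set QG) : set QG := @lspan ZG QG S.

Definition fracM (A B : set QG) : set QG :=
  frac_gen [set x | exists a b, [/\ A a, B b & x = a * b]].

(* The inverse (Z[G] : A) of an invertible fractional ideal A; it is a^-1 Z[G]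
   for A = a Z[G] with a invertible in Q[G]. *)
Definition fracV (A : set QG) : set QG :=
  [set x | forall a, A a -> range (@gratr G) (x * a)].

(* Fitt^[1] does not depend on the sequence 0 -> Y -> P -> X -> 0; it is
   computed from an arbitrary one. *)
Definition Fitt1 (X : lmodType ZG) : set QG :=
  xget set0 [set F | exists (Y P : lmodType ZG)
      (i : {linear Y -> P}) (p : {linear P -> X}),
    [/\ finite_set [set: Y], finite_set [set: P], pd_le1 P, short_exact i p
      & F = fracM (fracV (@gratr G @` Fitt P)) (@gratr G @` Fitt Y)]].

End FractionalIdeals.

Section Data.
Variables (G : finAbGroupType) (I D : {group G}).
Local Notation ZG := (gring int G).
Local Notation QG := (gring rat G).

Definition gA (phi : coset_of I) : gring int (coset_of I) :=
  1 - gelt int phi^-1%g + #|I|%:R.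

(* Z[G/I]/(g), as a Z[G]-module *)
Definition modA (phi : coset_of I) : lmodType ZG :=
  restr (@gproj int G I) (cyc_quot (gA phi)).

(* (nu_I / #I) * phi^-1 in Q[G], computed with the lift phit of phi *)
Definition idem_frob (phit : G) : QG :=
  gconst G (#|I|%:R^-1 : rat) * gsum rat I * gelt rat phit^-1%g.

Definition elt_h (phit : G) : QG := 1 - idem_frob phit + gsum rat I.

(* Z_i: products over the subsets L of the s indices with #L = s - i *)
Definition Zideal (s : nat) (Is : 'I_s -> {group G}) (i : nat) : set ZG :=
  ideal_gen [set x | exists L : {set 'I_s},
    #|L| = (s - i)%N /\ x = \prod_(l in L) gsum int (Is l)].

Definition aug_ker : set ZG := [set x | @gproj int G D x = 0].

Definition Jideal (s : nat) (Is : 'I_s -> {group G}) : set ZG :=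
  ideal_gen [set x | exists i,
    (1 <= i <= s)%N /\ idealM (Zideal Is i) (idealX aug_ker i.-1) x].

End Data.

(* Main.v *)
Require Import Defs.
From HB Require Import structures.
From mathcomp Require Import all_boot all_algebra all_fingroup all_solvable.
From mathcomp Require Import ring.
From mathcomp Require Import boolp classical_sets cardinality.

(* Write R = Z[G], let sigma_l generate I_l, put t_l = sigma_l - 1, let nu_l be
   the norm of I_l, and lift g to the regular element f = 1 - phit^-1 + #I of R.

   If P is finite of projective dimension at most 1, the module of relations
   between generators of P is projective, by Schanuel's lemma, and of full rank.
   A dual basis of it and the Cauchy-Binet formula show that Fitt(P) is
   invertible and that Fitt(W) = Fitt(P) Fitt(Y) for an extension W of P by Y,
   without localising. For 0 -> Y -> P -> X -> 0 and 0 -> Y' -> P' -> X -> 0 the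
   pullback of P and P' over X is an extension in two ways, whence
   Fitt(P) Fitt(Y') = Fitt(P') Fitt(Y): the ideal Fitt^[1](X) does not depend on
   the sequence. Therefore Fitt^[1](A) = f^-1 Fitt(Y0), where Y0 is the kernel
   of R/(f) -> A, generated by the classes of the t_l.

   The relations between these classes are generated by nu_l e_l, by the Koszul
   relations t_l e_k - t_k e_l and by f e_l. In the expansion of the maximal
   minors, the terms which involve no multiple of f vanish except nu_I, and
     Fitt(Y0) = (nu_I) + f sum_(i >= 1) Z_i (f, t_1, ..., t_s)^(i-1).

   Since h nu_I = f nu_I, multiplying by h f^-1 leaves (nu_I) unchanged and
   turns the factor f of the second summand into h. Finally h is congruent to
   1 - (nu_I / #I) phi^-1 modulo nu_I, and (f, t_1, ..., t_s) to I_D. *)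

Set Implicit Arguments.
Unset Strict Implicit.
Unset Printing Implicit Defensive.

Import GRing.Theory.
Local Open Scope classical_set_scope.
Local Open Scope ring_scope.

(** * Spans, linear combinations and ideals *)

Section Span.
Variables (R : comNzRingType) (M : lmodType R).
Implicit Types (S T : set M).

Lemma lspan_incl S : S `<=` lspan S.
Proof.
move=> x Sx; exists 1%N, (fun=> 1), (fun=> x); split=> //.
by rewrite big_ord1 scale1r.
Qed.

Lemma lspanbP S x : reflect (lspan S x) (x \in lspanb S).
Proof. exact: asboolP. Qed.

Lemma lspan0 S : lspan S 0.
Proof. exact/lspanbP/rpred0. Qed.

Lemma lspanD S x y : lspan S x -> lspan S y -> lspan S (x + y).
Proof. by move=> /lspanbP Sx /lspanbP Sy; apply/lspanbP/rpredD. Qed.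

Lemma lspanN S x : lspan S x -> lspan S (- x).
Proof. by move=> /lspanbP Sx; apply/lspanbP; rewrite rpredN. Qed.

Lemma lspanZ S a x : lspan S x -> lspan S (a *: x).
Proof. by move=> /lspanbP Sx; apply/lspanbP/lspanbZ. Qed.

Lemma lspan_sum S (J : Type) (r : seq J) (P : pred J) (F : J -> M) :
  (forall j, P j -> lspan S (F j)) -> lspan S (\sum_(j <- r | P j) F j).
Proof.
by move=> SF; apply: (big_ind (lspan S)) => //; [exact: lspan0|exact: lspanD].
Qed.

Lemma lspan_ind S (Q : M -> Prop) :
  Q 0 -> (forall a x y, S x -> Q y -> Q (a *: x + y)) ->
  forall x, lspan S x -> Q x.
Proof.
move=> Q0 QD x [n [a [v [Sv ->]]]]; elim/big_rec: _ => //= i y _ Qy.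
exact: QD.
Qed.

Lemma lspan_sub S T : S `<=` lspan T -> lspan S `<=` lspan T.
Proof.
move=> ST; apply: lspan_ind; first exact: lspan0.
by move=> a x y Sx Ty; apply: lspanD => //; apply/lspanZ/ST.
Qed.

Lemma lspanS S T : S `<=` T -> lspan S `<=` lspan T.
Proof. by move=> ST; apply: lspan_sub => x /ST; apply: lspan_incl. Qed.

End Span.

Section IdealGen.
Variable R : comNzRingType.
Implicit Types (A B S T : set R).

Lemma ideal_gen_incl S : S `<=` ideal_gen S.
Proof. exact: (@lspan_incl _ R^o). Qed.

Lemma ideal_gen0 S : ideal_gen S 0.
Proof. exact: (@lspan0 _ R^o). Qed.

Lemma ideal_genD S x y : ideal_gen S x -> ideal_gen S y -> ideal_gen S (x + y).
Proof. exact: (@lspanD _ R^o). Qed.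

Lemma ideal_genN S x : ideal_gen S x -> ideal_gen S (- x).
Proof. exact: (@lspanN _ R^o). Qed.

Lemma ideal_genMl S a x : ideal_gen S x -> ideal_gen S (a * x).
Proof. exact: (@lspanZ _ R^o). Qed.

Lemma ideal_genMr S a x : ideal_gen S x -> ideal_gen S (x * a).
Proof. by rewrite mulrC; apply: ideal_genMl. Qed.

Lemma ideal_gen_sum S (J : Type) (r : seq J) (P : pred J) (F : J -> R) :
  (forall j, P j -> ideal_gen S (F j)) ->
  ideal_gen S (\sum_(j <- r | P j) F j).
Proof. exact: (@lspan_sum _ R^o). Qed.

Lemma ideal_gen_ind S (Q : R -> Prop) :
  Q 0 -> (forall a x y, S x -> Q y -> Q (a * x + y)) ->
  forall x, ideal_gen S x -> Q x.
Proof. exact: (@lspan_ind _ R^o). Qed.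

Lemma ideal_gen_sub S T : S `<=` ideal_gen T -> ideal_gen S `<=` ideal_gen T.
Proof. exact: (@lspan_sub _ R^o). Qed.

Lemma ideal_genS S T : S `<=` T -> ideal_gen S `<=` ideal_gen T.
Proof. exact: (@lspanS _ R^o). Qed.

Lemma ideal_genM S T U :
  (forall x y, S x -> T y -> ideal_gen U (x * y)) ->
  forall x y, ideal_gen S x -> ideal_gen T y -> ideal_gen U (x * y).
Proof.
move=> STU x y Sx Ty; move: x Sx; apply: ideal_gen_ind => [|a x b Sx IHb].
  by rewrite mul0r; apply: ideal_gen0.
rewrite mulrDl -mulrA; apply: ideal_genD => //; apply: ideal_genMl.
move: y Ty {IHb}; apply: ideal_gen_ind => [|c y d Ty IHd].
  by rewrite mulr0; apply: ideal_gen0.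
by rewrite mulrDr mulrCA; apply: ideal_genD => //; apply/ideal_genMl/STU.
Qed.

Lemma ideal_gen_set1 (g a : R) : ideal_gen [set g] a <-> exists b, a = b * g.
Proof.
split=> [|[b ->]]; last exact/ideal_genMl/ideal_gen_incl.
move: a; apply: ideal_gen_ind; first by exists 0; rewrite mul0r.
by move=> a _ _ -> [b ->]; exists (a + b); rewrite mulrDl.
Qed.

Lemma idealM_incl A B a b : A a -> B b -> idealM A B (a * b).
Proof. by move=> Aa Bb; apply: ideal_gen_incl; exists a, b. Qed.

Lemma idealM_sub A B S : (forall a b, A a -> B b -> ideal_gen S (a * b)) ->
  idealM A B `<=` ideal_gen S.
Proof.
by move=> AB; apply: ideal_gen_sub => _ [a [b [Aa Bb ->]]]; apply: AB.
Qed.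

End IdealGen.

Section Families.
Variable R : comNzRingType.

Section LinComb.
Variables (M : lmodType R) (n : nat) (x : 'I_n -> M).

Definition lincomb (v : 'rV[R]_n) : M := \sum_j v 0 j *: x j.

Lemma lincomb_is_linear : linear lincomb.
Proof.
move=> a u v; rewrite /lincomb scaler_sumr -big_split; apply: eq_bigr => j _.
by rewrite !mxE scalerDl scalerA.
Qed.

HB.instance Definition _ := GRing.isLinear.Build R 'rV[R]_n M *:%R lincomb
  lincomb_is_linear.

End LinComb.

Definition fcat (T : Type) m n (x : 'I_m -> T) (y : 'I_n -> T)
    (i : 'I_(m + n)) : T :=
  match split i with inl j => x j | inr j => y j end.

Lemma fcat_lshift (T : Type) m n (x : 'I_m -> T) (y : 'I_n -> T) j :
  fcat x y (lshift n j) = x j.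
Proof. by rewrite /fcat (unsplitK (inl j)). Qed.

Lemma fcat_rshift (T : Type) m n (x : 'I_m -> T) (y : 'I_n -> T) j :
  fcat x y (rshift m j) = y j.
Proof. by rewrite /fcat (unsplitK (inr j)). Qed.

Lemma range_fcat (T : Type) m n (x : 'I_m -> T) (y : 'I_n -> T) :
  range (fcat x y) = range x `|` range y.
Proof.
apply/seteqP; split=> [_ [i _ <-]|v [[j _ <-]|[j _ <-]]].
- by rewrite /fcat; case: split => j; [left|right]; exists j.
- by exists (lshift n j); rewrite ?fcat_lshift.
by exists (rshift m j); rewrite ?fcat_rshift.
Qed.

Section LinCombTheory.
Variable M : lmodType R.

Lemma lincomb_delta n (x : 'I_n -> M) j : lincomb x (delta_mx 0 j) = x j.
Proof.
rewrite /lincomb (bigD1 j) //= big1 => [|i ij]; rewrite mxE eqxx /=.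
  by rewrite eqxx scale1r addr0.
by rewrite (negbTE ij) scale0r.
Qed.

Lemma lincomb0 n (v : 'rV_n) : lincomb (fun=> 0 : M) v = 0.
Proof. by rewrite /lincomb big1 // => j _; rewrite scaler0. Qed.

Lemma lincomb_row m n (x : 'I_n -> M) (B : 'M[R]_(m, n)) i :
  lincomb x (row i B) = \sum_j B i j *: x j.
Proof. by apply: eq_bigr => j _; rewrite mxE. Qed.

Lemma lincomb_mul m n (x : 'I_n -> M) (v : 'rV_m) (B : 'M[R]_(m, n)) :
  lincomb x (v *m B) = lincomb (fun i => lincomb x (row i B)) v.
Proof.
by rewrite mulmx_sum_row linear_sum; apply: eq_bigr => i _; rewrite linearZ.
Qed.

Lemma lincomb_fcat m n (x : 'I_m -> M) (y : 'I_n -> M) u v :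
  lincomb (fcat x y) (row_mx u v) = lincomb x u + lincomb y v.
Proof.
rewrite /lincomb big_split_ord; congr (_ + _); apply: eq_bigr => j _ /=.
  by rewrite row_mxEl fcat_lshift.
by rewrite row_mxEr fcat_rshift.
Qed.

Lemma linear_lincomb (N : lmodType R) (f : {linear M -> N}) n
    (x : 'I_n -> M) v :
  f (lincomb x v) = lincomb (f \o x) v.
Proof. by rewrite linear_sum; apply: eq_bigr => j _; rewrite linearZ. Qed.

Lemma lspan_rangeP n (x : 'I_n -> M) v :
  lspan (range x) v <-> exists c, v = lincomb x c.
Proof.
split=> [|[c ->]]; last first.
  by apply: lspan_sum => j _; apply/lspanZ/lspan_incl; exists j.
move: v; apply: lspan_ind; first by exists 0; rewrite linear0.
move=> a _ _ [j _ <-] [c ->]; exists (a *: delta_mx 0 j + c).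
by rewrite linearP /= lincomb_delta.
Qed.

End LinCombTheory.
End Families.

Lemma ideal_gen_rangeP (R : comNzRingType) n (t : 'I_n -> R) a :
  ideal_gen (range t) a <-> exists c : 'I_n -> R, a = \sum_j c j * t j.
Proof.
split=> [/(@lspan_rangeP R R^o)[c ->]|[c ->]]; first by exists (c 0).
by apply: ideal_gen_sum => j _; apply/ideal_genMl/ideal_gen_incl; exists j.
Qed.

(** * Fitting ideals of families *)

Section FittingFamilies.
Variables (R : comNzRingType) (M : lmodType R).

Definition relation_mx m n (x : 'I_n -> M) (B : 'M[R]_(m, n)) : Prop :=
  forall i, lincomb x (row i B) = 0.

Lemma relation_mx_mul l m n (x : 'I_n -> M) (A : 'M_(l, m)) (B : 'M_(m, n)) :
  relation_mx x B -> relation_mx x (A *m B).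
Proof.
move=> xB i; rewrite row_mul lincomb_mul /lincomb big1 // => j _.
by have := xB j; rewrite /lincomb => ->; rewrite scaler0.
Qed.

Lemma relation_mx_col l m n (x : 'I_n -> M) (A : 'M_(l, n)) (B : 'M_(m, n)) :
  relation_mx x A -> relation_mx x B -> relation_mx x (col_mx A B).
Proof.
by move=> xA xB i; case: (split_ordP i) => j ->; rewrite ?rowKu ?rowKd.
Qed.

Lemma fitt_of_det n (x : 'I_n -> M) (B : 'M[R]_n) :
  relation_mx x B -> fitt_of x (\det B).
Proof.
move=> xB; apply: ideal_gen_incl; exists B; split=> // i.
by rewrite -lincomb_row.
Qed.

Lemma fitt_of_ind n (x : 'I_n -> M) (Q : R -> Prop) :
  Q 0 -> (forall a B y, relation_mx x B -> Q y -> Q (a * \det B + y)) ->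
  forall c, fitt_of x c -> Q c.
Proof.
move=> Q0 QD; apply: ideal_gen_ind => // a _ y [B [xB ->]]; apply: QD => i.
by rewrite lincomb_row.
Qed.

Lemma fitt_of_sub n (x : 'I_n -> M) (S : set R) :
  (forall B, relation_mx x B -> ideal_gen S (\det B)) ->
  fitt_of x `<=` ideal_gen S.
Proof.
move=> xS; apply: fitt_of_ind => [|a B y xB Sy]; first exact: ideal_gen0.
by apply: ideal_genD => //; apply/ideal_genMl/xS.
Qed.

Lemma fitt_of_behead0 n (x : 'I_n.+1 -> M) :
  x ord0 = 0 -> fitt_of x `<=` fitt_of (x \o lift ord0).
Proof.
move=> x0; apply: fitt_of_sub => B xB.
rewrite (expand_det_col _ ord0); apply: ideal_gen_sum => i _.
do 2!apply: ideal_genMl; apply: fitt_of_det => k.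
have xBi := xB (lift i k).
rewrite lincomb_row big_ord_recl x0 scaler0 add0r in xBi.
by rewrite lincomb_row -[RHS]xBi; apply: eq_bigr => j _; rewrite !mxE.
Qed.

Lemma fitt_of_fcat0 m n (x : 'I_n -> M) :
  fitt_of (fcat (fun _ : 'I_m => 0) x) `<=` fitt_of x.
Proof.
elim: m => [|m IHm].
  rewrite (_ : fcat (fun _ : 'I_0 => 0) x = x) //; apply: funext => i.
  by rewrite -[in LHS](_ : rshift 0 i = i) ?fcat_rshift //; apply: val_inj.
pose x0 : 'I_(m + n).+1 -> M := fcat (fun _ : 'I_m.+1 => 0) x.
have x0_behead : x0 \o lift ord0 = fcat (fun _ : 'I_m => 0) x.
  apply: funext => i /=; rewrite /x0; case: (split_ordP i) => j ->.
    rewrite (_ : lift _ _ = lshift n (lift ord0 j)) ?fcat_lshift //.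
    exact: val_inj.
  rewrite (_ : lift _ _ = rshift m.+1 j) ?fcat_rshift //; exact: val_inj.
apply: subset_trans IHm; rewrite -x0_behead; apply: fitt_of_behead0.
rewrite /x0 (_ : ord0 = lshift n (ord0 : 'I_m.+1)) ?fcat_lshift //.
exact: val_inj.
Qed.

Lemma fitt_of_fcatM m n (z : 'I_m -> M) (x : 'I_n -> M) (B : 'M_m)
    (C : 'M_(m, n)) a :
  relation_mx (fcat z x) (row_mx B C) -> fitt_of x a ->
  fitt_of (fcat z x) (\det B * a).
Proof.
move=> zxBC; move: a; apply: fitt_of_ind => [|a A y xA IHy].
  by rewrite mulr0; apply: ideal_gen0.
rewrite mulrDr; apply: ideal_genD => //; rewrite mulrCA -(det_ublock B C A).
apply/ideal_genMl/fitt_of_det/relation_mx_col => // i.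
by rewrite row_row_mx row0 lincomb_fcat linear0 add0r xA.
Qed.

Lemma fitt_of_span_sub m n (x : 'I_m -> M) (y : 'I_n -> M) :
  range x `<=` lspan (range y) -> range y `<=` lspan (range x) ->
  fitt_of x `<=` fitt_of y.
Proof.
move=> xy yx.
have /fin_all_exists[u xE] i : exists u, x i = lincomb y u.
  by apply/lspan_rangeP/xy; exists i.
have /fin_all_exists[v yE] j : exists v, y j = lincomb x v.
  by apply/lspan_rangeP/yx; exists j.
pose U := \matrix_i u i; pose V := \matrix_j v j.
have yU w : lincomb y (w *m U) = lincomb x w.
  by rewrite lincomb_mul; apply: eq_bigr => i _; rewrite rowK -xE.
apply: fitt_of_sub => B xB; apply: (@fitt_of_fcat0 m).
(* The last n columns of this block matrix are relations of y. *)
have -> : \det B = \det (block_mx B (B *m U) (- V) (1%:M - V *m U)).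
  have -> : block_mx B (B *m U) (- V) (1%:M - V *m U) =
            block_mx B 0 (- V) 1%:M *m block_mx 1%:M U 0 1%:M.
    by rewrite mulmx_block !(mulmx0, mulmx1, mul0mx, addr0) mulNmx addrC.
  by rewrite det_mulmx det_lblock det_ublock !det1 !mulr1.
apply/fitt_of_det/relation_mx_col => i.
  by rewrite row_row_mx lincomb_fcat lincomb0 add0r row_mul yU xB.
rewrite row_row_mx lincomb_fcat lincomb0 add0r linearB /= linearB /= row_mul yU.
by rewrite row1 lincomb_delta rowK -yE subrr.
Qed.

Lemma fitt_of_span m n (x : 'I_m -> M) (y : 'I_n -> M) :
  lspan (range x) = lspan (range y) -> fitt_of x = fitt_of y.
Proof.
move=> xy.
have x_y : range x `<=` lspan (range y) by rewrite -xy; apply: lspan_incl.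
have y_x : range y `<=` lspan (range x) by rewrite xy; apply: lspan_incl.
by apply/seteqP; split; apply: fitt_of_span_sub.
Qed.

Lemma FittE n (x : 'I_n -> M) : lspan (range x) = setT -> Fitt M = fitt_of x.
Proof.
move=> xT; rewrite /Fitt; case: xgetP => [J _ [m [y [yT ->]]]|/(_ (fitt_of x))].
  by apply: fitt_of_span; rewrite xT yT.
by case; exists n, x.
Qed.

Lemma finite_generators : finite_set [set: M] ->
  exists n (x : 'I_n -> M), lspan (range x) = setT.
Proof.
case/finite_seqP => r rE; exists (size r), (fun i => nth 0 r i).
apply/seteqP; split=> // v _; apply: lspan_incl.
have vr : v \in r by have : [set: M] v by []; rewrite rE.
rewrite -index_mem in vr; exists (Ordinal vr) => //=.
by rewrite nth_index // -index_mem.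
Qed.

End FittingFamilies.

Lemma fitt_of_inj (R : comNzRingType) (M N : lmodType R) (i : {linear M -> N})
    n (x : 'I_n -> M) :
  injective i -> fitt_of (i \o x) = fitt_of x.
Proof.
move=> i_inj; apply/seteqP; split; apply: fitt_of_sub => B xB;
  apply: fitt_of_det => k.
  by apply: i_inj; rewrite linear_lincomb xB linear0.
by rewrite -linear_lincomb xB linear0.
Qed.

(** * The Cauchy-Binet formula *)

Section CauchyBinet.
Variable R : comNzRingType.

Lemma sum_uniq_tuples_sorted (V : nmodType) m n (F : n.-tuple 'I_m -> V) :
  \sum_(t : n.-tuple 'I_m | uniq t) F t =
  \sum_(t : n.-tuple 'I_m | sorted (relpre val ltn) t)
    \sum_(s : 'S_n) F [tuple tnth t (s i) | i < n].
Proof.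
pose leqI : rel 'I_m := relpre val leq.
have sortedE (t : n.-tuple 'I_m) :
    sorted (relpre val ltn) t = uniq t && sorted leqI t.
  by rewrite -!sorted_map ltn_sorted_uniq_leq map_inj_uniq //; apply: val_inj.
have leqI_total : total leqI by move=> i j; apply: leq_total.
pose inc (t : n.-tuple 'I_m) := [tuple of sort leqI t].
rewrite (partition_big inc (sorted (relpre val ltn))) => [|t ut]; last first.
  by rewrite sortedE /= sort_uniq ut sort_sorted.
apply: eq_bigr => t0; rewrite sortedE => /andP[ut0 st0].
pose h (s : 'S_n) := [tuple tnth t0 (s i) | i < n].
have h_inj : injective h.
  move=> s s' hss'; apply/permP => i; apply: (tuple_uniqP _ ut0).
  rewrite -[LHS](tnth_mktuple (fun i => tnth t0 (s i))) -/(h s) hss'.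
  by rewrite tnth_mktuple.
have fiberE (t : n.-tuple 'I_m) :
    (uniq t && (inc t == t0)) = (t \in (h @: [set: 'S_n])%SET).
  have -> : (uniq t && (inc t == t0)) = perm_eq t t0.
    apply/andP/idP => [[_ /eqP <-]|tt0]; first by rewrite perm_sym perm_sort.
    rewrite (perm_uniq tt0) ut0; split=> //; apply/eqP/val_inj.
    apply: (sorted_eq _ _ (sort_sorted leqI_total t) st0).
    - by move=> i j k; apply: leq_trans.
    - by move=> i j /anti_leq/val_inj.
    by rewrite perm_sort.
  apply/tuple_permP/imsetP => [[s ts]|[s _ ->]]; exists s => //; exact: val_inj.
rewrite (eq_bigl _ _ fiberE) big_imset /=; last exact: in2W.
by apply: eq_bigl => s; rewrite inE.
Qed.

Lemma det_mulmx_rowsub m n (A : 'M[R]_(n, m)) (B : 'M[R]_(m, n)) :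
  \det (A *m B) =
  \sum_(t : n.-tuple 'I_m) (\prod_i A i (tnth t i)) * \det (rowsub (tnth t) B).
Proof.
rewrite /determinant.
under eq_bigr => s _.
  under eq_bigr => i _ do rewrite mxE.
  rewrite bigA_distr_bigA mulr_sumr /=.
  over.
rewrite exchange_big (reindex (fun t : n.-tuple 'I_m => [ffun i => tnth t i])).
  apply: eq_bigr => t _; rewrite mulr_sumr; apply: eq_bigr => s _.
  rewrite big_split /= mulrCA; congr (_ * (_ * _)).
    by apply: eq_bigr => i _; rewrite ffunE.
  by apply: eq_bigr => i _; rewrite mxE ffunE.
exists (fun f : {ffun 'I_n -> 'I_m} => [tuple f i | i < n]) => [t _|f _].
  by apply: eq_from_tnth => i; rewrite tnth_mktuple ffunE.
by apply/ffunP => i; rewrite ffunE tnth_mktuple.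
Qed.

Lemma Cauchy_Binet m n (A : 'M[R]_(n, m)) (B : 'M[R]_(m, n)) :
  \det (A *m B) = \sum_(t : n.-tuple 'I_m | sorted (relpre val ltn) t)
    \det (colsub (tnth t) A) * \det (rowsub (tnth t) B).
Proof.
rewrite det_mulmx_rowsub (bigID (fun t : n.-tuple 'I_m => uniq t)) /=.
rewrite [X in _ + X]big1 => [|t /negP ut]; last first.
  have [i [j [ij tij]]] : exists i j, i != j /\ tnth t i = tnth t j.
    apply: contrapT => no; apply: ut; apply/tuple_uniqP => i j tij.
    by apply/eqP; apply: contrapT => /negP ij; apply: no; exists i, j.
  by rewrite (determinant_alternate ij) ?mulr0 // => k; rewrite !mxE tij.
rewrite addr0 sum_uniq_tuples_sorted; apply: eq_bigr => t _.
rewrite [\det (colsub _ _)]/determinant mulr_suml; apply: eq_bigr => s _.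
rewrite (_ : rowsub _ B = row_perm s (rowsub (tnth t) B)); last first.
  by apply/matrixP => i j; rewrite !mxE tnth_mktuple.
rewrite row_permE det_mulmx det_perm mulrCA mulrA; congr (_ * _ * _).
by apply: eq_bigr => i _; rewrite mxE tnth_mktuple.
Qed.

End CauchyBinet.

(** * Kernels and projective modules *)

Section Kernel.
Variables (R : comNzRingType) (M N : lmodType R) (f : {linear M -> N}).

Definition in_kernel : {pred M} := fun x => f x == 0.

Lemma in_kernel_submod_closed : submod_closed in_kernel.
Proof.
split=> [|a x y]; first by rewrite unfold_in linear0.
by rewrite !unfold_in linearP => /eqP-> /eqP->; rewrite scaler0 addr0.
Qed.

HB.instance Definition _ := GRing.isSubmodClosed.Build R M in_kernel
  in_kernel_submod_closed.

Record lkernel :=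
  LKernel { lkernel_val : M; lkernelP : lkernel_val \in in_kernel }.

HB.instance Definition _ := [isSub for lkernel_val].
HB.instance Definition _ := [Choice of lkernel by <:].
HB.instance Definition _ := [SubChoice_isSubLmodule of lkernel by <:].

Lemma lkernel_eq0 (x : lkernel) : f (val x) = 0.
Proof. by apply/eqP; case: x. Qed.

Lemma lkernel_surj x : f x = 0 -> exists y : lkernel, val y = x.
Proof. by move=> /eqP fx; exists (LKernel fx). Qed.

Lemma short_exact_lkernel : (forall z, exists y, f y = z) ->
  short_exact (val : {linear lkernel -> M}) f.
Proof.
move=> f_surj; split=> [|//|y]; first exact: val_inj.
by split=> [/lkernel_surj|[x <-]]; last exact: lkernel_eq0.
Qed.

Lemma finite_lkernel : finite_set [set: M] -> finite_set [set: lkernel].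
Proof.
move=> Mfin; rewrite -[setT](preimage_setT (val : lkernel -> M)).
by apply: finite_preimage => // x y _ _; apply: val_inj.
Qed.

End Kernel.

Section Projective.
Variable R : comNzRingType.

Lemma linear_factor (M N K : lmodType R) (i : {linear K -> N})
    (f : {linear M -> N}) :
  injective i -> (forall x, exists y, i y = f x) ->
  exists g : {linear M -> K}, i \o g =1 f.
Proof.
move=> i_inj /choice[g gE].
have g_linear : linear g.
  by move=> a x y; apply: i_inj; rewrite linearP !gE linearP.
pose gL := GRing.isLinear.Build R M K *:%R g g_linear.
by exists (HB.pack_for {linear M -> K} g gL).
Qed.

Lemma linear_descent (M N Q : lmodType R) (p : {linear M -> Q})
    (f : {linear M -> N}) :
  (forall u, exists x, p x = u) -> (forall x, p x = 0 -> f x = 0) ->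
  exists g : {linear Q -> N}, g \o p =1 f.
Proof.
move=> /choice[sec secE] pf.
have f_sec x : f (sec (p x)) = f x.
  by apply/eqP; rewrite -subr_eq0 -linearB pf // linearB secE subrr.
have g_linear : linear (f \o sec).
  by move=> a u v /=; rewrite -linearP -[RHS]f_sec linearP !secE.
pose gL := GRing.isLinear.Build R Q N *:%R _ g_linear.
by exists (HB.pack_for {linear Q -> N} (f \o sec) gL).
Qed.

Lemma projective_row n : projective ('rV[R]_n : lmodType R).
Proof.
move=> N N' p f p_surj.
have /fin_all_exists[y yE] j : exists y, p y = f (delta_mx 0 j).
  exact: p_surj.
exists (lincomb y) => v /=.
rewrite linear_sum [in RHS](row_sum_delta v) linear_sum.
by apply: eq_bigr => j _; rewrite !linearZ yE.
Qed.

(* Schanuel's lemma, in the form needed here: lifting [e : F0 -> P] and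
   [w : F -> P] through each other, one writes any b in the kernel K of w as
   alpha (beta b) + (b - alpha (beta b)), so that K is a retract of F1 + F. *)
Lemma projective_lkernel (P F : lmodType R) (w : {linear F -> P}) :
  pd_le1 P -> projective F -> (forall z, exists y, w y = z) ->
  projective (lkernel w).
Proof.
case=> F1 [F0 [d [e [F1proj F0proj [d_inj e_surj deE]]]]] Fproj w_surj.
have [alpha alphaE] := F0proj _ _ w e w_surj.
have [beta betaE] := Fproj _ _ e w e_surj.
have /(linear_factor val_inj)[alphad alphadE] x : exists y : lkernel w,
    val y = (alpha \o d) x.
  by apply: lkernel_surj; rewrite [LHS]alphaE; apply/deE; exists x.
have /(linear_factor val_inj)[rest restE] b : exists y : lkernel w,
    val y = (idfun \- (alpha \o beta)) b.
  apply: lkernel_surj; rewrite linearB /=.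
  by rewrite [X in _ - X]alphaE [X in _ - X]betaE subrr.
have [gamma gammaE] : exists g : {linear lkernel w -> F1},
    d \o g =1 beta \o val.
  by apply: linear_factor => // b; apply/deE; rewrite [LHS]betaE lkernel_eq0.
move=> N N' p f p_surj.
have [lift1 lift1E] := F1proj _ _ p (f \o alphad) p_surj.
have [lift2 lift2E] := Fproj _ _ p (f \o rest) p_surj.
exists ((lift1 \o gamma) \+ (lift2 \o val)) => b /=.
rewrite linearD /= [p _ in LHS]lift1E [X in _ + X]lift2E /= -linearD.
congr (f _).
apply: val_inj; rewrite linearD /= [X in X + _]alphadE [X in _ + X]restE /=.
by rewrite [d _]gammaE addrC subrK.
Qed.

End Projective.

(** * Dual bases of modules of relations *)

Lemma inj_map_mx (aT rT : Type) (f : aT -> rT) m n :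
  injective f -> injective (map_mx f : 'M_(m, n) -> 'M_(m, n)).
Proof.
move=> f_inj A B /matrixP AB; apply/matrixP => i j; apply: f_inj.
by have := AB i j; rewrite !mxE.
Qed.

Section DualBasis.
Variables (R S : comNzRingType) (f : {rmorphism R -> S}).
Hypothesis f_inj : injective f.

(* After the extension of scalars [f], the columns of [Phi] become coordinate
   forms on the module of relations between the [w j]: they send relations to
   elements of R and form, together with the rows of [k], a dual basis of it. *)
Definition dual_basis (P : lmodType R) m n (w : 'I_n -> P)
    (k : 'M[R]_(m, n)) (Phi : 'M[S]_(n, m)) : Prop :=
  [/\ relation_mx w k,
      forall b, lincomb w b = 0 -> exists c, map_mx f c = map_mx f b *m Phi
    & Phi *m map_mx f k = 1%:M].

Section Theory.
Variables (P : lmodType R) (m n : nat) (w : 'I_n -> P).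
Variables (k : 'M[R]_(m, n)) (Phi : 'M[S]_(n, m)).

Lemma dual_basis_coord l (B : 'M[R]_(l, n)) :
  dual_basis w k Phi -> relation_mx w B ->
  exists2 C, B = C *m k & map_mx f C = map_mx f B *m Phi.
Proof.
case=> _ dual kPhi wB.
have /fin_all_exists[c cE] i : exists c, map_mx f c = map_mx f (row i B) *m Phi.
  exact/dual/wB.
have CE : map_mx f (\matrix_i c i) = map_mx f B *m Phi.
  by apply/row_matrixP => i; rewrite -map_row rowK cE row_mul map_row.
exists (\matrix_i c i) => //; apply: (inj_map_mx f_inj).
by rewrite map_mxM CE -mulmxA kPhi mulmx1.
Qed.

Lemma dual_basis_minors : dual_basis w k Phi ->
  \sum_(t : n.-tuple 'I_m | sorted (relpre val ltn) t)
    \det (colsub (tnth t) Phi) * f (\det (rowsub (tnth t) k)) = 1.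
Proof.
case=> _ _ kPhi; rewrite -[RHS](det1 S n) -kPhi Cauchy_Binet.
by apply: eq_bigr => t _; rewrite -det_map_mx map_mxsub.
Qed.

Lemma fitt_of_minor t : dual_basis w k Phi ->
  fitt_of w (\det (rowsub (tnth t) k)).
Proof. by case=> kw _ _; apply: fitt_of_det => i; rewrite row_rowsub. Qed.

Lemma fitt_of_minor_dual c (t : n.-tuple 'I_m) :
  dual_basis w k Phi -> fitt_of w c ->
  exists d, \det (colsub (tnth t) Phi) * f c = f d.
Proof.
move=> kPhi; move: c; apply: fitt_of_ind => [|a B y wB [d dE]].
  by exists 0; rewrite !rmorph0 mulr0.
have [C _ CE] := dual_basis_coord kPhi wB.
exists (a * \det (colsub (tnth t) C) + d).
rewrite !rmorphD !rmorphM /= mulrDr dE mulrCA; congr (_ * _ + _).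
by rewrite -!det_map_mx mulrC -det_mulmx map_mxsub CE mulmx_colsub.
Qed.

(* A section of k over the projective module of relations gives coordinates,
   and N b = sum_j b_j (N e_j) computes those of b from those of the N e_j. *)
Lemma dual_basis_exists (N : R) (u : S) :
  f N * u = 1 -> (forall j, N *: w j = 0) -> projective (lkernel (lincomb w)) ->
  relation_mx w k -> (forall b, lincomb w b = 0 -> exists c, b = c *m k) ->
  exists Psi, dual_basis w k Psi.
Proof.
move=> Nu Nw Kproj kw k_gen.
have /(linear_factor val_inj)[kappa kappaE] v : exists y : lkernel (lincomb w),
    val y = mulmxr k v.
  apply: lkernel_surj; rewrite /= lincomb_mul /lincomb big1 // => j _.
  by rewrite [\sum_ _ _]kw scaler0.
have kappa_surj y : exists v, kappa v = y.
  have [c cE] := k_gen _ (lkernel_eq0 y); exists c; apply: val_inj.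
  by rewrite [LHS]kappaE.
have [sec secE] := Kproj _ _ kappa idfun kappa_surj.
have sec_k b : sec b *m k = val b by rewrite -[LHS]kappaE /= [kappa _]secE.
have /fin_all_exists[Ne NeE] j : exists y : lkernel (lincomb w),
    val y = N *: delta_mx 0 j.
  by apply: lkernel_surj; rewrite linearZ /= lincomb_delta.
pose E := \matrix_j sec (Ne j).
have N_sec b : N *: sec b = val b *m E.
  have NbE : N *: b = \sum_j val b 0 j *: Ne j.
    apply: val_inj; rewrite linearZ linear_sum /=.
    rewrite [in LHS](row_sum_delta (lkernel_val b)) scaler_sumr.
    by apply: eq_bigr => j _; rewrite linearZ /= NeE !scalerA mulrC.
  rewrite -linearZ NbE linear_sum mulmx_sum_row.
  by apply: eq_bigr => j _; rewrite linearZZ rowK.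
exists (u *: map_mx f E); split=> // [b wb|].
  have [y yb] := lkernel_surj wb; exists (sec y).
  rewrite -scalemxAr -map_mxM -yb -N_sec map_mxZ scalerA.
  by rewrite mulrC Nu scale1r.
rewrite -scalemxAl -map_mxM.
have -> : E *m k = N%:M.
  apply/row_matrixP => j.
  by rewrite row_mul rowK sec_k NeE -scalemx1 linearZ /= row1.
by rewrite map_scalar_mx scale_scalar_mx mulrC Nu.
Qed.

End Theory.
End DualBasis.

(** * Fitting ideals of extensions *)

Section Extension.
Variables (R S : comNzRingType) (f : {rmorphism R -> S}).
Hypothesis f_inj : injective f.
Variables (M P : lmodType R) (q : {linear M -> P}).
Variables (l n : nat) (x : 'I_l -> M) (z : 'I_n -> M).
Hypothesis qx : forall i, q (x i) = 0.
Hypothesis ker_q : forall v, q v = 0 -> lspan (range x) v.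

Lemma lift_relation_mx m (k : 'M[R]_(m, n)) : relation_mx (q \o z) k ->
  exists C : 'M_(m, l), relation_mx (fcat z x) (row_mx k C).
Proof.
move=> zk; have /fin_all_exists[c cE] i : exists c,
    lincomb z (row i k) = lincomb x c.
  by apply/lspan_rangeP/ker_q; rewrite linear_lincomb.
exists (- \matrix_i c i) => i.
by rewrite row_row_mx lincomb_fcat cE linearN linearN /= rowK subrr.
Qed.

Lemma relation_mx_lsubmx m (B : 'M[R]_(m, n + l)) :
  relation_mx (fcat z x) B -> relation_mx (q \o z) (lsubmx B).
Proof.
move=> zxB i; rewrite -[RHS](linear0 q) -(zxB i) -[in RHS](hsubmxK B).
rewrite row_row_mx lincomb_fcat linearD !linear_lincomb.
rewrite [X in _ + X](_ : _ = 0) ?addr0 //.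
by rewrite /lincomb big1 // => j _; rewrite /= qx scaler0.
Qed.

(* The relations B of the [z j] and [x i] restrict to relations c k of the
   [q (z j)]; subtracting c times a lift of k leaves relations of the [x i]. *)
Lemma fitt_of_fcat_minor m (k : 'M[R]_(m, n)) (Phi : 'M[S]_(n, m)) c
    (t : n.-tuple 'I_m) :
  dual_basis f (q \o z) k Phi -> fitt_of (fcat z x) c ->
  exists2 d, fitt_of x d & \det (colsub (tnth t) Phi) * f c = f d.
Proof.
move=> kPhi; have [C kC] : exists C, relation_mx (fcat z x) (row_mx k C).
  by apply: lift_relation_mx; case: kPhi.
move: c; apply: fitt_of_ind => [|a B y zxB [d xd dE]].
  by exists 0; rewrite ?rmorph0 ?mulr0 //; apply: ideal_gen0.
have [c cE fc] := dual_basis_coord f_inj kPhi (relation_mx_lsubmx zxB).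
pose B' : 'M_(n + l) := row_mx (colsub (tnth t) c) (rsubmx B - c *m C).
have xB' : fitt_of x (\det B').
  apply/(@fitt_of_fcat0 _ _ n)/fitt_of_det => i.
  rewrite row_row_mx lincomb_fcat lincomb0 add0r.
  have c_rel := relation_mx_mul c kC i; have B_rel := zxB i.
  rewrite mul_mx_row row_row_mx lincomb_fcat -cE in c_rel.
  rewrite -(hsubmxK B) row_row_mx lincomb_fcat in B_rel.
  apply: (addrI (lincomb z (row i (lsubmx B)))).
  rewrite linearB linearB /= addr0 addrA B_rel sub0r.
  by apply/esym/eqP; rewrite -addr_eq0 c_rel.
exists (a * \det B' + d); first by apply: ideal_genD => //; apply: ideal_genMl.
rewrite !rmorphD !rmorphM /= mulrDr dE mulrCA; congr (_ * _ + _).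
have -> : \det (colsub (tnth t) Phi) =
    \det (block_mx (colsub (tnth t) Phi) (- (Phi *m map_mx f C)) 0 1%:M).
  by rewrite det_ublock det1 mulr1.
rewrite -!det_map_mx mulrC -det_mulmx -{1}(hsubmxK B) map_row_mx mul_row_block.
rewrite mulmx0 mulmx1 addr0 mulmxN mulmxA -fc -map_mxM addrC -map_mxB.
by rewrite mulmx_colsub -fc -map_mxsub -map_row_mx.
Qed.

Lemma fitt_of_fcat m (k : 'M[R]_(m, n)) (Phi : 'M[S]_(n, m)) :
  dual_basis f (q \o z) k Phi ->
  fitt_of (fcat z x) = idealM (fitt_of (q \o z)) (fitt_of x).
Proof.
move=> kPhi; apply/seteqP; split=> [c zxc|]; last first.
  apply: idealM_sub => a b za xb; move: a za.
  apply: fitt_of_ind => [|a B y zB IHy].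
    by rewrite mul0r; apply: ideal_gen0.
  rewrite mulrDl -mulrA; apply: ideal_genD => //; apply: ideal_genMl.
  by have [C BC] := lift_relation_mx zB; apply: fitt_of_fcatM BC xb.
have /choice[d dE] t : exists d, fitt_of x d /\
    \det (colsub (tnth t) Phi) * f c = f d.
  by have [d xd dE] := fitt_of_fcat_minor t kPhi zxc; exists d.
have -> : c = \sum_(t : n.-tuple 'I_m | sorted (relpre val ltn) t)
    \det (rowsub (tnth t) k) * d t.
  apply: f_inj; rewrite -[f c]mul1r -(dual_basis_minors kPhi).
  rewrite mulr_suml rmorph_sum.
  by apply: eq_bigr => t _; rewrite rmorphM /= -(dE t).2 mulrAC mulrC.
apply: ideal_gen_sum => t _; apply: idealM_incl (dE t).1.
exact: fitt_of_minor kPhi.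
Qed.

End Extension.

(** * Finite modules over Z[G] *)

Section GroupRing.
Variables (R : comNzRingType) (G : finAbGroupType).

Lemma gcoef0 x : gcoef (0 : gring R G) x = 0.
Proof. by rewrite /gcoef ffunE. Qed.

Lemma gcoef_sum (J : Type) (r : seq J) (P : pred J) (F : J -> gring R G) x :
  gcoef (\sum_(j <- r | P j) F j) x = \sum_(j <- r | P j) gcoef (F j) x.
Proof. by elim/big_rec2: _ => [|j a b _ <-]; rewrite ?gcoefD // gcoef0. Qed.

Lemma gcoef_constM c (a : gring R G) x :
  gcoef (gconst G c * a) x = c * gcoef a x.
Proof.
rewrite gcoefM (bigD1 1%g) //= big1 => [|y /negbTE ny].
  by rewrite {1}/gcoef ffunE eqxx invg1 mul1g addr0.
by rewrite {1}/gcoef ffunE ny mul0r.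
Qed.

Lemma gcoef_natM n (a : gring R G) x : gcoef (n%:R * a) x = n%:R * gcoef a x.
Proof.
rewrite !mulr_natl; elim: n => [|n IHn]; last by rewrite !mulrS gcoefD IHn.
by rewrite !mulr0n gcoef0.
Qed.

End GroupRing.

Lemma finite_torsion (R : pzRingType) (P : lmodType R) (w : P) :
  finite_set [set: P] -> exists2 N, (0 < N)%N & w *+ N = 0.
Proof.
move=> Pfin; apply: contrapT => no_torsion.
suff inj : injective (fun k => w *+ k).
  apply: infinite_nat; rewrite -[setT](preimage_setT (fun k => w *+ k)).
  by apply: finite_preimage => // k l _ _; apply: inj.
have lt_neq k l : (k < l)%N -> w *+ k <> w *+ l.
  move=> kl wkl; apply: no_torsion; exists (l - k)%N; first by rewrite subn_gt0.
  by rewrite mulrnBr 1?ltnW // wkl subrr.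
by move=> k l wkl; case: (ltngtP k l) => // /lt_neq; rewrite wkl.
Qed.

Section IntegralGroupRing.
Variable G : finAbGroupType.
Local Notation ZG := (gring int G).
Local Notation QG := (gring rat G).

Lemma gconst_natV n : (0 < n)%N -> gconst G (n%:R^-1 : rat) * n%:R = 1.
Proof.
move=> n0; apply: gringP => x.
rewrite gcoef_constM -[X in gcoef X]mulr1 gcoef_natM.
by rewrite mulKf // Num.Theory.pnatr_eq0 -lt0n.
Qed.

Lemma gratr_inj : injective (@gratr G).
Proof.
move=> a b ab; apply: gringP => x; apply/eqP.
have := congr1 (fun c => gcoef c x) ab.
by rewrite !gratrE => /eqP; rewrite eqr_int.
Qed.

Definition gresidue N (r : {ffun G -> 'I_N}) : ZG :=
  [ffun x => (r x : nat)%:Z] : {ffun G -> int}.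

Lemma gresidue_decomp N (a : ZG) : (0 < N)%N ->
  exists (r : {ffun G -> 'I_N}) (b : ZG), a = gresidue r + N%:R * b.
Proof.
move=> N0.
exists [ffun x => Ordinal (ltn_pmod `|(gcoef a x %% N)%Z|%N N0)].
exists ([ffun x => (gcoef a x %/ N)%Z] : {ffun G -> int}).
apply: gringP => x; rewrite gcoefD gcoef_natM /gcoef !ffunE /= natz.
rewrite addrC mulrC -/(gcoef _ _) {1}[gcoef a x](divz_eq _ N); congr (_ + _).
set r := (_ %% _)%Z.
have r0 : 0 <= r by rewrite modz_ge0 // -lt0n.
have rN : r < N by rewrite ltz_pmod.
by rewrite modn_small ?gez0_abs // -ltz_nat gez0_abs.
Qed.

(* The module of relations is generated by N Z[G]^n and by those relations
   whose coefficients are reduced modulo N. *)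
Lemma relation_mx_generators (P : lmodType ZG) n (w : 'I_n -> P) N :
  (0 < N)%N -> (forall j, N%:R *: w j = 0) -> exists m (k : 'M[ZG]_(m, n)),
    relation_mx w k /\ forall b, lincomb w b = 0 -> exists c, b = c *m k.
Proof.
move=> N0 Nw; pose T := {ffun 'I_n -> {ffun G -> 'I_N}}.
have wN : relation_mx w (N%:R%:M : 'M[ZG]_n).
  by move=> i; rewrite -scalemx1 linearZ /= row1 linearZ /= lincomb_delta Nw.
pose reduced (r : T) : 'rV[ZG]_n := \row_j gresidue (r j).
pose reduced_relation (r : T) :=
  if lincomb w (reduced r) == 0 then reduced r else 0.
pose k := \matrix_(i < #|T|) reduced_relation (enum_val i).
exists (#|T| + n)%N, (col_mx k N%:R%:M); split=> [|b wb].
  apply: relation_mx_col => // i; rewrite rowK /reduced_relation.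
  by case: eqP => // _; rewrite linear0.
have /fin_all_exists[r /fin_all_exists[b' bE]] j := gresidue_decomp (b 0 j) N0.
have {}bE : b = reduced [ffun j => r j] + (\row_j b' j) *m N%:R%:M.
  by apply/rowP => j; rewrite mul_mx_scalar !mxE ffunE bE.
exists (row_mx (delta_mx 0 (enum_rank [ffun j => r j])) (\row_j b' j)).
rewrite mul_row_col -rowE rowK enum_rankK /reduced_relation.
have -> : lincomb w (reduced [ffun j => r j]) = 0; last by rewrite eqxx -bE.
rewrite -[LHS]addr0 -[in LHS](_ : lincomb w ((\row_j b' j) *m N%:R%:M) = 0).
  by rewrite -linearD -bE.
have := relation_mx_mul (\row_j b' j) wN 0.
rewrite (_ : row 0 _ = (\row_j b' j) *m N%:R%:M) //.
by apply/rowP => j; rewrite mxE.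
Qed.

Lemma pd_le1_dual_basis (P : lmodType ZG) n (w : 'I_n -> P) :
  finite_set [set: P] -> pd_le1 P -> lspan (range w) = setT ->
  exists m (k : 'M[ZG]_(m, n)) (Phi : 'M[QG]_(n, m)),
    dual_basis (@gratr G) w k Phi.
Proof.
move=> Pfin Ppd wT.
have [N N0 Nw] : exists2 N, (0 < N)%N & forall j, N%:R *: w j = 0.
  have /fin_all_exists2[Nj Nj0 Njw] j := finite_torsion (w j) Pfin.
  exists (\prod_j Nj j)%N => [|j]; first by rewrite prodn_gt0.
  by rewrite scaler_nat (bigD1 j) //= mulrnA Njw mul0rn.
have w_surj y : exists v, lincomb w v = y.
  have /lspan_rangeP[v ->] : lspan (range w) y by rewrite wT.
  by exists v.
have Kproj := projective_lkernel Ppd (@projective_row _ n) w_surj.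
have [m [k [wk k_gen]]] := relation_mx_generators N0 Nw.
exists m, k; apply: (dual_basis_exists _ Nw Kproj wk k_gen).
  by rewrite rmorph_nat mulrC; apply: gconst_natV.
Qed.

Lemma Fitt_ext (Y M P : lmodType ZG) (i : {linear Y -> M})
    (q : {linear M -> P}) :
  finite_set [set: Y] -> finite_set [set: P] -> pd_le1 P -> short_exact i q ->
  Fitt M = idealM (Fitt P) (Fitt Y).
Proof.
move=> Yfin Pfin Ppd [i_inj q_surj iqE].
have [l [y yT]] := finite_generators Yfin.
have [n [w wT]] := finite_generators Pfin.
have [m [k [Phi kPhi]]] := pd_le1_dual_basis Pfin Ppd wT.
have /fin_all_exists[z zE] j := q_surj (w j).
have wE : w = q \o z by apply: funext => j /=; rewrite zE.
have qi v : q (i v) = 0 by apply/iqE; exists v.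
have ker_q v : q v = 0 -> lspan (range (i \o y)) v.
  move=> /iqE[u <-]; have /lspan_rangeP[c ->] : lspan (range y) u by rewrite yT.
  by apply/lspan_rangeP; exists c; rewrite linear_lincomb.
have zyT : lspan (range (fcat z (i \o y))) = setT.
  apply/seteqP; split=> // v _.
  have /lspan_rangeP[c qv] : lspan (range w) (q v) by rewrite wT.
  rewrite -[v](subrK (lincomb z c)) range_fcat; apply: lspanD.
    apply: (lspanS (@subsetUr _ _ _)); apply: ker_q.
    by rewrite linearB qv linear_lincomb -wE subrr.
  by apply: (lspanS (@subsetUl _ _ _)); apply/lspan_rangeP; exists c.
rewrite (FittE zyT) (FittE wT) (FittE yT) -(fitt_of_inj y i_inj) wE.
rewrite wE in kPhi; apply: (fitt_of_fcat gratr_inj _ ker_q kPhi) => j.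
exact: qi.
Qed.

End IntegralGroupRing.

(** * Independence of the presentation *)

Section Pullback.
Variable R : comNzRingType.

Definition is_pullback (W P P' X : lmodType R)
    (q : {linear W -> P}) (q' : {linear W -> P'})
    (p : {linear P -> X}) (p' : {linear P' -> X}) : Prop :=
  [/\ p \o q =1 p' \o q', injective (fun w => (q w, q' w))
    & forall u u', p u = p' u' -> exists2 w, q w = u & q' w = u'].

Lemma is_pullback_sym (W P P' X : lmodType R)
    (q : {linear W -> P}) (q' : {linear W -> P'})
    (p : {linear P -> X}) (p' : {linear P' -> X}) :
  is_pullback q q' p p' -> is_pullback q' q p' p.
Proof.
case=> pq q_inj q_lift; split=> [w|w1 w2 [q'w qw]|u' u p'u'].
- by rewrite pq.
- by apply: q_inj; rewrite q'w qw.
by have [w qw q'w] := q_lift u u' (esym p'u'); exists w.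
Qed.

Lemma pullback_exists (P P' X : lmodType R) (p : {linear P -> X})
    (p' : {linear P' -> X}) :
  exists (W : lmodType R) (q : {linear W -> P}) (q' : {linear W -> P'}),
    is_pullback q q' p p'.
Proof.
pose delta : {linear (P * P')%type -> X} := (p \o fst) \- (p' \o snd).
pose pr : {linear lkernel delta -> (P * P')%type} := val.
exists (lkernel delta), (fst \o pr), (snd \o pr); split=> [w|w1 w2 E|u u' puu'].
- by apply/eqP; rewrite -subr_eq0; have /eqP := lkernel_eq0 w.
- by apply: val_inj; rewrite [LHS]surjective_pairing [RHS]surjective_pairing.
have [w wE] : exists w : lkernel delta, val w = (u, u').
  by apply: lkernel_surj; rewrite /delta /= puu' subrr.
by exists w; rewrite /= wE.
Qed.

End Pullback.

Lemma Fitt_same_range (R : comNzRingType) (Y Y' P : lmodType R)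
    (i : {linear Y -> P}) (i' : {linear Y' -> P}) :
  finite_set [set: Y] -> injective i -> injective i' -> range i = range i' ->
  Fitt Y = Fitt Y'.
Proof.
move=> Yfin i_inj i'_inj ii'; have [n [y yT]] := finite_generators Yfin.
have /fin_all_exists[y' y'E] j : exists v, i' v = i (y j).
  have : range i' (i (y j)) by rewrite -ii'; exists (y j).
  by case=> v _ vE; exists v.
have y'T : lspan (range y') = setT.
  apply/seteqP; split=> // v _; have [u _ uE] : range i (i' v).
    by rewrite ii'; exists v.
  have /lspan_rangeP[c uc] : lspan (range y) u by rewrite yT.
  apply/lspan_rangeP; exists c; apply: i'_inj.
  rewrite -uE uc !linear_lincomb; congr (lincomb _ c).
  by apply: funext => j /=; rewrite y'E.
rewrite (FittE yT) (FittE y'T) -(fitt_of_inj y i_inj) -(fitt_of_inj y' i'_inj).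
by congr fitt_of; apply: funext => j /=; rewrite y'E.
Qed.

Section Fitt1.
Variable G : finAbGroupType.
Local Notation ZG := (gring int G).
Local Notation QG := (gring rat G).

Lemma Fitt_pullback (W P P' X Y' : lmodType ZG)
    (q : {linear W -> P}) (q' : {linear W -> P'})
    (p : {linear P -> X}) (p' : {linear P' -> X}) (i' : {linear Y' -> P'}) :
  finite_set [set: Y'] -> finite_set [set: P] -> pd_le1 P ->
  short_exact i' p' -> is_pullback q q' p p' ->
  Fitt W = idealM (Fitt P) (Fitt Y').
Proof.
move=> Y'fin Pfin Ppd [i'_inj p'_surj i'p'] [pq q_inj q_lift].
pose j : {linear lkernel q -> P'} := q' \o val.
have j_inj : injective j.
  by move=> u v juv; apply/val_inj/q_inj; rewrite !lkernel_eq0 [q' _]juv.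
have range_j : range j = range i'.
  apply/seteqP; split=> [_ [u _ <-]|_ [v _ <-]].
    have /i'p'[v vE] : p' (j u) = 0.
      by rewrite -[LHS]pq /= lkernel_eq0 linear0.
    by exists v.
  have p'i'v : p 0 = p' (i' v) by rewrite linear0; apply/esym/i'p'; exists v.
  have [w /lkernel_surj[u <-] q'w] := q_lift _ _ p'i'v.
  by exists u.
have kernel_fin : finite_set [set: lkernel q].
  rewrite (_ : setT = j @^-1` range i'); last first.
    by apply/seteqP; split=> // u _; rewrite -range_j; exists u.
  by apply: finite_preimage; [move=> u v _ _; apply: j_inj|exact: finite_image].
have q_surj u : exists w, q w = u.
  have [u' p'u'] := p'_surj (p u); have [w qw _] := q_lift _ _ (esym p'u').
  by exists w.
rewrite (Fitt_ext kernel_fin Pfin Ppd (short_exact_lkernel q_surj)).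
by rewrite (Fitt_same_range kernel_fin j_inj i'_inj range_j).
Qed.

Lemma Fitt_Schanuel (Y P Y' P' X : lmodType ZG)
    (i : {linear Y -> P}) (p : {linear P -> X})
    (i' : {linear Y' -> P'}) (p' : {linear P' -> X}) :
  finite_set [set: Y] -> finite_set [set: P] -> pd_le1 P -> short_exact i p ->
  finite_set [set: Y'] -> finite_set [set: P'] -> pd_le1 P' ->
  short_exact i' p' ->
  idealM (Fitt P) (Fitt Y') = idealM (Fitt P') (Fitt Y).
Proof.
move=> Yfin Pfin Ppd ip Y'fin P'fin P'pd ip'.
have [W [q [q' Wpb]]] := pullback_exists p p'.
rewrite -(Fitt_pullback Y'fin Pfin Ppd ip' Wpb).
exact: Fitt_pullback Yfin P'fin P'pd ip (is_pullback_sym Wpb).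
Qed.

Lemma fracM_incl (A B : set QG) a b : A a -> B b -> fracM A B (a * b).
Proof. by move=> Aa Bb; apply: lspan_incl; exists a, b. Qed.

Lemma Fitt_invertible (P : lmodType ZG) : finite_set [set: P] -> pd_le1 P ->
  fracM (fracV (@gratr G @` Fitt P)) (@gratr G @` Fitt P) 1.
Proof.
move=> Pfin Ppd; have [n [w wT]] := finite_generators Pfin.
have [m [k [Phi kPhi]]] := pd_le1_dual_basis Pfin Ppd wT.
rewrite (FittE wT) -(dual_basis_minors kPhi); apply: lspan_sum => t _.
apply: fracM_incl; last by apply: imageP; apply: fitt_of_minor kPhi.
move=> _ [c wc <-]; have [d ->] := fitt_of_minor_dual (@gratr_inj G) t kPhi wc.
by exists d.
Qed.

(* a' b = sum_j a_j b'_j in A B', hence u b = sum_i u'_i (u a'_i b) with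
   u a'_i b in B'. *)
Lemma fracVM_sub (A B A' S' : set ZG) :
  fracM (fracV (@gratr G @` A')) (@gratr G @` A') 1 ->
  idealM A' B `<=` idealM A (ideal_gen S') ->
  fracM (fracV (@gratr G @` A)) (@gratr G @` B) `<=`
  fracM (fracV (@gratr G @` A')) (@gratr G @` ideal_gen S').
Proof.
move=> A'1 A'B; apply: lspan_sub => _ [u [_ [uA [b Bb <-] ->]]].
have uAB' c : idealM A (ideal_gen S') c ->
    (@gratr G @` ideal_gen S') (u * gratr c).
  move: c; apply: ideal_gen_ind => [|e _ y [a [b' [Aa B'b' ->]]] [d B'd dE]].
    by exists 0; rewrite ?rmorph0 ?mulr0 //; apply: ideal_gen0.
  have [r _ rE] := uA _ (imageP (@gratr G) Aa).
  exists (e * (r * b') + d).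
    by apply: ideal_genD => //; do 2!apply: ideal_genMl.
  by rewrite !rmorphD !rmorphM /= dE rE mulrDr; ring.
suff A'ub v : fracM (fracV (@gratr G @` A')) (@gratr G @` A') v ->
    fracM (fracV (@gratr G @` A')) (@gratr G @` ideal_gen S')
      (v * (u * gratr b)).
  by rewrite -[u * _]mul1r; apply: A'ub.
move: v; apply: lspan_ind; first by rewrite mul0r; apply: lspan0.
move=> e _ y [u' [_ [u'A' [a' A'a' <-] ->]]] IHy.
rewrite mulrDl; apply: lspanD => //.
rewrite -[e *: _]/(gratr e * _) -mulrA; apply: (@lspanZ ZG QG).
have -> : u' * gratr a' * (u * gratr b) = u' * (u * gratr (a' * b)).
  by rewrite rmorphM; ring.
by apply: fracM_incl => //; apply: uAB'; apply/A'B/idealM_incl.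
Qed.

Lemma Fitt_ideal (M : lmodType ZG) : finite_set [set: M] ->
  exists S, Fitt M = ideal_gen S.
Proof.
by move=> /finite_generators[n [x xT]]; rewrite (FittE xT); eexists.
Qed.

Lemma Fitt1E (X Y P : lmodType ZG) (i : {linear Y -> P}) (p : {linear P -> X}) :
  finite_set [set: Y] -> finite_set [set: P] -> pd_le1 P -> short_exact i p ->
  Fitt1 X = fracM (fracV (@gratr G @` Fitt P)) (@gratr G @` Fitt Y).
Proof.
move=> Yfin Pfin Ppd ip; rewrite /Fitt1; set F0 := fracM _ _.
case: xgetP => [F _|/(_ F0)]; last by case; exists Y, P, i, p.
case=> [Y' [P' [i' [p' [Y'fin P'fin P'pd ip' ->]]]]]; rewrite /F0.
have PY' := Fitt_Schanuel Yfin Pfin Ppd ip Y'fin P'fin P'pd ip'.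
have [S SE] := Fitt_ideal Yfin; have [S' S'E] := Fitt_ideal Y'fin.
apply/seteqP; split; [rewrite SE|rewrite S'E]; apply: fracVM_sub;
  rewrite -?SE -?S'E ?PY' //; exact: Fitt_invertible.
Qed.

End Fitt1.

(** * The ideals Z_i and J of a family *)

Section NormIdeals.
Variables (R : comNzRingType) (s : nat) (nu : 'I_s -> R).
Implicit Types A B : set R.

(* For the norms of the I_l and the ideal I_D these are, by definition, the
   ideals [Zideal] and [Jideal]. *)
Definition Zideal_of (i : nat) : set R :=
  ideal_gen [set x | exists L : {set 'I_s},
    #|L| = (s - i)%N /\ x = \prod_(l in L) nu l].

Definition Jideal_of A : set R :=
  ideal_gen [set x | exists i,
    (1 <= i <= s)%N /\ idealM (Zideal_of i) (idealX A i.-1) x].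

Lemma idealM_mod A B A' B' n :
  A `<=` ideal_gen (A' `|` [set n]) -> B `<=` ideal_gen (B' `|` [set n]) ->
  idealM A B `<=` ideal_gen (idealM A' B' `|` [set n]).
Proof.
move=> AA' BB'; apply: idealM_sub => a b /AA' A'a /BB' B'b.
move: a b A'a B'b; apply: ideal_genM => a b [A'a|->] => [[B'b|->]|_].
- by apply: ideal_gen_incl; left; apply: idealM_incl.
- by apply/ideal_genMl/ideal_gen_incl; right.
by apply/ideal_genMr/ideal_gen_incl; right.
Qed.

Lemma idealX_mod A A' n k : A `<=` ideal_gen (A' `|` [set n]) ->
  idealX A k `<=` ideal_gen (idealX A' k `|` [set n]).
Proof.
move=> AA'; elim: k => [|k IHk].
  by move=> a _; apply: ideal_gen_incl; left.
exact: idealM_mod.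
Qed.

Lemma Jideal_of_mod A A' n : A `<=` ideal_gen (A' `|` [set n]) ->
  Jideal_of A `<=` ideal_gen (Jideal_of A' `|` [set n]).
Proof.
move=> AA'; apply: ideal_gen_sub => x [i [i_le_s Zx]].
have ZZ : Zideal_of i `<=` ideal_gen (Zideal_of i `|` [set n]).
  by move=> z Zz; apply: ideal_gen_incl; left.
move: (idealM_mod ZZ (idealX_mod (k := i.-1) AA') Zx).
apply: ideal_genS => y [Zy|->]; [left|by right].
by apply: ideal_gen_incl; exists i.
Qed.

Lemma idealX_prod A (I : finType) (T : {set I}) (F : I -> R) :
  (forall i, A (F i)) -> idealX A #|T| (\prod_(i in T) F i).
Proof.
move=> AF; rewrite -big_enum cardE; elim: (enum _) => //= i r IHr.
by rewrite big_cons; apply: idealM_incl.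
Qed.

Lemma Jideal_of_prod A (i0 : 'I_s) (c a : 'I_s -> R) : (forall j, A (a j)) ->
  Jideal_of A (\prod_(j | j != i0) (nu j * c j + a j)).
Proof.
move=> Aa; pose norm_part j := if j != i0 then nu j * c j else 0.
pose rest j := if j != i0 then a j else 1.
rewrite big_mkcond (eq_bigr (fun j => norm_part j + rest j)); last first.
  by move=> j _; rewrite /norm_part /rest; case: ifP => _; rewrite ?add0r.
rewrite bigA_distr; apply: ideal_gen_sum => L _.
have [i0L|i0L] := boolP (i0 \in L).
  by rewrite (bigD1 i0) //= i0L /norm_part eqxx mul0r; apply: ideal_gen0.
have -> : \prod_j (if j \in L then norm_part j else rest j) =
    \prod_(j in L) c j * (\prod_(j in L) nu j * \prod_(j in ~: (i0 |: L)) a j).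
  rewrite mulrA -big_split [LHS](bigID (mem L)) /=; congr (_ * _).
    apply: eq_bigr => j Lj; rewrite Lj /norm_part mulrC ifT //.
    by apply: contraTneq Lj => ->.
  rewrite big_mkcond [RHS]big_mkcond; apply: eq_bigr => j _.
  by rewrite !inE /rest; case: (j == i0) (j \in L) => [] [].
apply/ideal_genMl/ideal_gen_incl; exists (s - #|L|)%N.
have cardL : (#|L| < s)%N.
  rewrite -[X in (_ < X)%N](card_ord s) -[X in (_ < X)%N]cardsT.
  apply: proper_card; rewrite properT; apply: contraNneq i0L => ->.
  by rewrite inE.
split; first by rewrite subn_gt0 cardL leq_subr.
apply: idealM_incl.
  by apply: ideal_gen_incl; exists L; rewrite subKn // ltnW.
rewrite (_ : _.-1 = #|~: (i0 |: L)|); first exact: idealX_prod.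
by rewrite [RHS]cardsCs finset.setCK cardsU1 i0L card_ord subnS.
Qed.

Variables (T : Type) (F : T -> R).

Lemma idealX_range n : idealX (ideal_gen (range F)) n `<=`
  ideal_gen [set \prod_(o <- v) F o | v in [set v : seq T | size v = n]].
Proof.
elim: n => [|n IHn] a.
  move=> _; rewrite -[a]mulr1; apply/ideal_genMl/ideal_gen_incl.
  by exists [::]; rewrite ?big_nil.
apply: idealM_sub => x y Fx /IHn; move: x y Fx.
apply: ideal_genM => _ _ [o _ <-] [v vn <-]; apply: ideal_gen_incl.
by exists (o :: v); rewrite /= ?vn ?big_cons.
Qed.

Lemma Jideal_of_range : Jideal_of (ideal_gen (range F)) `<=`
  ideal_gen [set x | exists (L : {set 'I_s}) (v : seq T),
    #|~: L| = (size v).+1 /\ x = \prod_(l in L) nu l * \prod_(o <- v) F o].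
Proof.
apply: ideal_gen_sub => x [i [/andP[i_gt0 i_le_s]]].
apply: idealM_sub => z y Zz /idealX_range; move: z y Zz.
apply: ideal_genM => _ _ [L [cardL ->]] [v sz_v <-]; apply: ideal_gen_incl.
exists L, v; split=> //; apply/eqP.
by rewrite -(eqn_add2l #|L|) cardsC card_ord cardL sz_v prednK // subnK.
Qed.

End NormIdeals.

(** * Determinants of norm and Koszul relations *)

Section KoszulDeterminants.
Variable R : comNzRingType.

Lemma det_add_cols n (A B : 'M[R]_n) :
  \det (A + B) =
  \sum_(L : {set 'I_n}) \det (\matrix_(i, j) if j \in L then A i j else B i j).
Proof.
under [RHS]eq_bigr => L _ do rewrite -det_tr.
rewrite -det_tr /determinant exchange_big; apply: eq_bigr => p _ /=.
under eq_bigr => j _ do rewrite !mxE.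
rewrite bigA_distr -mulr_sumr; congr (_ * _); apply: eq_bigr => L _.
by apply: eq_bigr => j _; rewrite !mxE.
Qed.

Lemma eq_scale_det n (a : R) (A B : 'M[R]_n) : a *: A = a *: B ->
  a * \det A = a * \det B.
Proof.
move=> AB; suff prod_eq (J : Type) (r : seq J) (F F' : J -> R) :
    (forall j, a * F j = a * F' j) ->
    a * \prod_(j <- r) F j = a * \prod_(j <- r) F' j.
  rewrite /determinant !mulr_sumr; apply: eq_bigr => p _.
  rewrite mulrCA [RHS]mulrCA; congr (_ * _); apply: prod_eq => j.
  by move/matrixP/(_ j (p j)): AB; rewrite !mxE.
move=> FF'; elim: r => [|j r IHr]; first by rewrite !big_nil.
by rewrite !big_cons mulrCA IHr mulrCA mulrA FF' -mulrA.
Qed.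

Definition alternating n (S : 'M[R]_n) : Prop :=
  S^T = - S /\ forall i, S i i = 0.

Lemma alternating_form0 n (v : 'rV[R]_n) (S : 'M[R]_n) :
  alternating S -> v *m S *m v^T = 0.
Proof.
move=> [St Sii]; pose U := \matrix_(i, j) if (i < j)%N then S i j else 0.
have -> : S = U - U^T.
  apply/matrixP => i j; rewrite !mxE; case: ltngtP => [ij|ji|/val_inj->].
  - by rewrite subr0.
  - by have := congr1 (fun A : 'M_n => A j i) St; rewrite !mxE sub0r => ->.
  by rewrite Sii subr0.
have vUv : v *m U^T *m v^T = (v *m U *m v^T)^T.
  by rewrite !trmx_mul trmxK mulmxA.
rewrite mulmxBr mulmxBl vUv; apply/matrixP => i j.
by rewrite !ord1 !mxE subrr.
Qed.

End KoszulDeterminants.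

Lemma map_alternating (R S : comNzRingType) (f : {rmorphism R -> S}) n
    (A : 'M[R]_n) :
  alternating A -> alternating (map_mx f A).
Proof.
case=> At Aii; split=> [|i]; last by rewrite mxE Aii rmorph0.
by rewrite map_trmx At map_mxN.
Qed.

Section KoszulMinors.
Variables (R : comNzRingType) (s : nat).

(* The entries of [t] may be zero divisors; adding ['X] to the entry [c]
   makes it monic, hence regular, and M t^T = 0 then forces \det M = 0. *)
Lemma det_alternating_cols0 (L : {set 'I_s}) (C : 'M[R]_s) (t : 'rV[R]_s)
    (S : 'I_s -> 'M[R]_s) (c : 'I_s) :
  (forall i, alternating (S i)) -> (forall j, j \in L -> t 0 j = 0) ->
  c \notin L ->
  \det (\matrix_(i, j) if j \in L then C i j else (t *m S i) 0 j) = 0.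
Proof.
move=> Salt tL cL; set M := (X in \det X).
pose tX : 'rV[{poly R}]_s := map_mx polyC t + 'X *: delta_mx 0 c.
pose MX : 'M[{poly R}]_s := \matrix_(i, j)
  if j \in L then (C i j)%:P else (tX *m map_mx polyC (S i)) 0 j.
have tX_eval : map_mx (horner_eval 0) tX = t.
  by apply/rowP => j; rewrite !mxE /horner_eval !hornerE.
have -> : M = map_mx (horner_eval 0) MX.
  apply/matrixP => i j; rewrite !mxE /horner_eval; case: (j \in L).
    by rewrite hornerC.
  rewrite horner_sum; apply: eq_bigr => k _.
  by rewrite hornerM -[t in LHS]tX_eval mxE [map_mx _ _ _ _]mxE hornerC.
have MXt : MX *m tX^T = 0.
  apply/row_matrixP => i; rewrite row_mul row0.
  rewrite -[RHS](alternating_form0 tX (map_alternating polyC (Salt i))).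
  apply/rowP => k; rewrite !mxE; apply: eq_bigr => j _; rewrite !mxE.
  case: ifP => // jL.
  have /negbTE-> : j != c by apply: contraNneq cL => <-.
  by rewrite (ord1 k) tL // andbF mulr0 addr0 !mulr0.
have tXc_monic : tX 0 c \is monic by rewrite !mxE !eqxx mulr1 addrC monicXaddC.
rewrite det_map_mx; suff -> : \det MX = 0 by rewrite rmorph0.
apply: (monic_rreg tXc_monic); rewrite mul0r.
have := congr1 (mulmx (\adj MX)) MXt; rewrite mulmxA mul_adj_mx mulmx0.
by move/matrixP/(_ c 0); rewrite mul_scalar_mx !mxE.
Qed.

Variables (nu t : 'I_s -> R).
Hypothesis nu_t : forall j, nu j * t j = 0.

Lemma det_norm_koszul_cols0 (C : 'M[R]_s) (S : 'I_s -> 'M[R]_s)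
    (L : {set 'I_s}) :
  (forall i, alternating (S i)) -> L != [set: 'I_s]%SET ->
  \det (\matrix_(i, j) if j \in L then C i j * nu j
                       else ((\row_k t k) *m S i) 0 j) = 0.
Proof.
move=> Salt LT; have [c _ cL] : exists2 c, c \in [set: 'I_s]%SET & c \notin L.
  by apply/subsetPn; rewrite finset.subTset.
pose n := \prod_(j in L) nu j.
pose M (u : 'rV_s) := \matrix_(i, j) if j \in L then C i j else (u *m S i) 0 j.
pose t' : 'rV_s := \row_k if k \in L then 0 else t k.
have nt' : n *: (\row_k t k) = n *: t'.
  apply/rowP => k; rewrite !mxE; case: ifP => // kL.
  by rewrite /n (bigD1 k) //= mulr0 mulrAC nu_t mul0r.
transitivity (n * \det (M (\row_k t k))).
  have -> : n = \det (diag_mx (\row_j if j \in L then nu j else 1)).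
    by rewrite det_diag /n big_mkcond; apply: eq_bigr => j _; rewrite mxE.
  rewrite mulrC -det_mulmx; congr (\det _); apply/matrixP => i j.
  by rewrite mul_mx_diag !mxE; case: ifP => _; rewrite ?mulr1.
have -> : n * \det (M (\row_k t k)) = n * \det (M t').
  apply: eq_scale_det; apply/matrixP => i j; rewrite !mxE; case: ifP => // _.
  have := congr1 (fun u => (u *m S i) 0 j) nt'; rewrite -!scalemxAl.
  by rewrite !mxE.
rewrite (@det_alternating_cols0 L C t' S c) ?mulr0 // => j jL.
by rewrite mxE jL.
Qed.

Lemma det_norm_koszul (C K : 'M[R]_s) (S : 'I_s -> 'M[R]_s) :
  (forall i, alternating (S i)) -> (forall i, row i K = (\row_k t k) *m S i) ->
  \det (C *m diag_mx (\row_j nu j) + K) = \det C * \prod_j nu j.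
Proof.
move=> Salt KE; rewrite det_add_cols (bigD1 [set: 'I_s]%SET) //=.
rewrite big1 => [|L LT].
  have -> : \prod_j nu j = \det (diag_mx (\row_j nu j)).
    by rewrite det_diag; apply: eq_bigr => j _; rewrite mxE.
  rewrite addr0 -det_mulmx; congr (\det _).
  by apply/matrixP => i j; rewrite mxE inE.
rewrite -[RHS](@det_norm_koszul_cols0 C S L) //; congr (\det _).
apply/matrixP => i j; rewrite [LHS]mxE [RHS]mxE -KE mul_mx_diag.
by case: ifP => _; rewrite !mxE.
Qed.

End KoszulMinors.

(** * The Fitting ideal of norm and Koszul relations *)

Section FamilyOfSet.
Variables (R : comNzRingType) (M : lmodType R) (I : finType) (x : I -> M).
Implicit Types A L : {set I}.

Definition famset A (i : 'I_#|A|) : M := x (enum_val i).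

Lemma range_famset A : range (@famset A) = x @` [set` A].
Proof.
apply/seteqP; split=> [_ [i _ <-]|_ [i Ai <-]].
  by exists (enum_val i) => //; apply: enum_valP.
by exists (enum_rank_in Ai i) => //; rewrite /famset enum_rankK_in.
Qed.

Lemma fitt_of_famset0 : fitt_of (@famset finset.set0) 1.
Proof.
rewrite -(det1 R #|@finset.set0 I|); apply: fitt_of_det => i.
by have := enum_valP i; rewrite inE.
Qed.

Lemma fitt_of_famsetU A L (b : I -> R) a :
  (forall l, l \in L -> lspan (x @` [set` A]) (b l *: x l)) ->
  fitt_of (@famset A) a ->
  fitt_of (@famset (L :|: A)) (\prod_(l in L) b l * a).
Proof.
move=> bL xa.
have -> : fitt_of (@famset (L :|: A)) = fitt_of (fcat (@famset L) (@famset A)).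
  apply: fitt_of_span; rewrite range_fcat !range_famset -image_setU.
  by congr (lspan (x @` _)); apply/seteqP; split=> i /=; rewrite inE => /orP.
have /fin_all_exists[c cE] (i : 'I_#|L|) : exists c,
    b (enum_val i) *: x (enum_val i) = lincomb (@famset A) c.
  by apply/lspan_rangeP; rewrite range_famset; apply/bL/enum_valP.
have -> : \prod_(l in L) b l = \det (diag_mx (\row_(i < #|L|) b (enum_val i))).
  by rewrite det_diag big_enum_val; apply: eq_bigr => i _; rewrite mxE.
apply: (@fitt_of_fcatM _ _ _ _ _ _ _ (- \matrix_i c i)) xa => i.
rewrite row_row_mx lincomb_fcat row_diag_mx linearZ /= lincomb_delta mxE.
by rewrite [X in X + _]cE linearN linearN /= rowK subrr.
Qed.

End FamilyOfSet.

Section KoszulFitting.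
Variables (R : comNzRingType) (s : nat) (nu t : 'I_s -> R) (g : R).
Hypothesis nu_t : forall j, nu j * t j = 0.

Definition koszul_relation (v : 'rV[R]_s) : Prop := exists C S E,
  alternating S /\
  v = C *m diag_mx (\row_j nu j) + (\row_k t k) *m S + g *: E.

Let J : set R := Jideal_of nu (ideal_gen (range (oapp t g))).

Lemma perm_prod_koszul_mem (B : 'M[R]_s) (j0 : 'I_s) (p : 'S_s) :
  (forall i, exists E, B i j0 = g * E) ->
  (forall i j, j != j0 -> exists c a,
     ideal_gen (range (oapp t g)) a /\ B i j = nu j * c + a) ->
  exists2 a, J a & \prod_j B (p j) j = g * a.
Proof.
move=> gB nuB; have [E BE] := gB (p j0).
have /choice[c /choice[a caE]] j : exists c a, ideal_gen (range (oapp t g)) a /\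
    (j != j0 -> B (p j) j = nu j * c + a).
  have [_|jj0] := eqVneq j j0.
    by exists 0, 0; split=> //; apply: ideal_gen0.
  by have [c [a [Aa ->]]] := nuB (p j) j jj0; exists c, a.
exists (E * \prod_(j | j != j0) (nu j * c j + a j)).
  by apply/ideal_genMl/Jideal_of_prod => j; have [] := caE j.
rewrite mulrA (bigD1 j0) //= BE; congr (_ * _); apply: eq_bigr => j jj0.
by have [_ ->] := caE j.
Qed.

Lemma det_koszul_relations (B : 'M[R]_s) :
  (forall i, koszul_relation (row i B)) ->
  ideal_gen ([set \prod_j nu j] `|` [set g * a | a in J]) (\det B).
Proof.
move=> /fin_all_exists[C /fin_all_exists[S /fin_all_exists[E BE]]].
pose N := \matrix_i C i *m diag_mx (\row_j nu j).
pose K := \matrix_i ((\row_k t k) *m S i).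
have -> : B = N + K + g *: \matrix_i E i.
  apply/row_matrixP => i; rewrite !linearD linearZ /= row_mul !rowK.
  by have [_ ->] := BE i.
have K_mem i j : ideal_gen (range (oapp t g)) (K i j).
  rewrite !mxE; apply: ideal_gen_sum => k _; rewrite mxE.
  by apply/ideal_genMr/ideal_gen_incl; exists (Some k).
rewrite det_add_cols; apply: ideal_gen_sum => L _.
have [->|] := eqVneq L [set: 'I_s]%SET.
  rewrite (_ : (\matrix_(i, j) _) = N + K); last first.
    by apply/matrixP => i j; rewrite mxE inE.
  rewrite (@det_norm_koszul _ _ _ _ nu_t _ _ S) => [|i|i].
  - by apply/ideal_genMl/ideal_gen_incl; left.
  - by have [] := BE i.
  by rewrite rowK.
rewrite -finset.subTset => /subsetPn[j0 _ j0L].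
rewrite -det_tr /determinant; apply: ideal_gen_sum => p _; apply: ideal_genMl.
set W := (\matrix_(i, j) _).
have -> : \prod_j W^T j (p j) = \prod_j W (p j) j.
  by apply: eq_bigr => j _; rewrite mxE.
have [i|i j jj0|a Ja ->] := @perm_prod_koszul_mem W j0 p; last first.
- by apply: ideal_gen_incl; right; exists a.
- rewrite mxE; case: ifP => _.
    exists ((\matrix_i C i) i j), (K i j); split; first exact: K_mem.
    by rewrite mxE /N mul_mx_diag !mxE mulrC.
  exists 0, (g * (\matrix_i E i) i j); rewrite mulr0 add0r.
  split; last by rewrite [LHS]mxE.
  by apply/ideal_genMr/ideal_gen_incl; exists None.
by rewrite mxE (negbTE j0L); eexists; rewrite mxE.
Qed.

Variables (M : lmodType R) (x : 'I_s -> M).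
Hypothesis nu_x : forall l, nu l *: x l = 0.
Hypothesis t_x : forall l c, t l *: x c = t c *: x l.
Hypothesis g_x : forall l, g *: x l = 0.

(* Removing an index [c] outside [v] peels one factor off: the relation
   [t l *: x c = t c *: x l], or [g *: x c = 0], expresses a multiple of [x c]
   by the remaining generators. *)
Lemma fitt_of_koszul_monomial (v : seq (option 'I_s)) (A : {set 'I_s}) :
  (forall l, Some l \in v -> l \in A) -> #|A| = (size v).+1 ->
  fitt_of (famset x (A := A)) (g * \prod_(o <- v) oapp t g o).
Proof.
elim: v A => [|o v IHv] A vA cardA.
  rewrite big_nil -[A]finset.setU0 (_ : g = \prod_(l in A) g); last first.
    by rewrite prodr_const cardA.
  apply: fitt_of_famsetU => [l _|]; first by rewrite g_x; apply: lspan0.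
  exact: fitt_of_famset0.
have [c cA cv] : exists2 c, c \in A & Some c \notin o :: v.
  apply: contrapT => no.
  have Av : (#|[set Some l | l in A]%SET| <= size (o :: v))%N.
    apply: leq_trans (card_size _); apply/subset_leq_card/fintype.subsetP.
    move=> _ /imsetP[l lA ->]; apply: contrapT => /negP lv; apply: no.
    by exists l.
  by move: Av; rewrite card_imset ?cardA ?ltnn // => ? ? [].
have v_sub l : Some l \in o :: v -> l \in A :\ c.
  move=> lv; rewrite !inE vA // andbT.
  by apply: contraNneq cv => <-.
have -> : A = [set c]%SET :|: (A :\ c) by rewrite finset.setD1K.
have := @fitt_of_famsetU _ _ _ x (A :\ c) [set c]%SET (fun=> oapp t g o)
  (g * \prod_(o <- v) oapp t g o).
rewrite big_set1 big_cons mulrCA; apply.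
  move=> l /set1P->; case oE: o => [l0|] /=.
    rewrite t_x; apply/lspanZ/lspan_incl; exists l0 => //=.
    by apply: v_sub; rewrite oE mem_head.
  by rewrite g_x; apply: lspan0.
apply: IHv; last by move: cardA; rewrite (cardsD1 c) cA => -[].
by move=> l lv; apply: v_sub; rewrite inE lv orbT.
Qed.

Lemma fitt_of_setC (L : {set 'I_s}) a : fitt_of (famset x (A := ~: L)) a ->
  fitt_of x (\prod_(l in L) nu l * a).
Proof.
move=> xa; rewrite (_ : fitt_of x = fitt_of (famset x (A := L :|: ~: L))).
  by apply: fitt_of_famsetU => // l _; rewrite nu_x; apply: lspan0.
apply: fitt_of_span; rewrite range_famset finset.setUCr.
congr lspan; apply/seteqP.
by split=> [_ [i _ <-]|_ [i _ <-]]; exists i; rewrite /= ?inE.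
Qed.

Lemma fitt_of_prod_norm : fitt_of x (\prod_l nu l).
Proof.
have := @fitt_of_setC [set: 'I_s]%SET 1; rewrite mulr1.
rewrite (eq_bigl predT) => [|l]; last by rewrite inE.
by apply; rewrite finset.setCT; apply: fitt_of_famset0.
Qed.

Lemma fitt_of_koszul :
  (forall v, lincomb x v = 0 -> koszul_relation v) ->
  fitt_of x = ideal_gen ([set \prod_j nu j] `|` [set g * a | a in J]).
Proof.
move=> x_rel; apply/seteqP; split.
  apply: fitt_of_sub => B xB; apply: det_koszul_relations => i.
  exact/x_rel/xB.
apply: ideal_gen_sub => _ [->|[a /Jideal_of_range Ja <-]].
  exact: fitt_of_prod_norm.
move: a Ja; apply: ideal_gen_ind => [|b _ y [L [v [cardL ->]]] IHy].
  by rewrite mulr0; apply: ideal_gen0.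
rewrite mulrDr; apply: ideal_genD => //; rewrite mulrCA; apply: ideal_genMl.
rewrite mulrCA.
have [/existsP[l /andP[lv lL]]|/existsPn vL] :=
    boolP [exists l, (Some l \in v) && (l \in L)].
  rewrite (bigD1 l) //= (big_rem _ lv) /= [g * _]mulrCA mulrACA nu_t mul0r.
  exact: ideal_gen0.
apply/fitt_of_setC/fitt_of_koszul_monomial => // l lv.
by have := vL l; rewrite lv inE.
Qed.

End KoszulFitting.

(** * Norms and augmentation ideals in group rings *)

Section Norms.
Variables (R : comNzRingType) (G : finAbGroupType).
Implicit Types (H K : {group G}) (a : gring R G).

Definition gsub1 (x : G) : gring R G := gelt R x - 1.

Lemma gcoef_eltM x a y : gcoef (gelt R x * a) y = gcoef a (x^-1 * y)%g.
Proof.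
rewrite gcoefM (bigD1 x) //= big1 => [|w /negbTE wx].
  by rewrite gcoef_elt eqxx mul1r addr0.
by rewrite gcoef_elt wx mul0r.
Qed.

Lemma geltM x y : gelt R (x * y)%g = gelt R x * gelt R y :> gring R G.
Proof.
apply: gringP => z; rewrite gcoef_eltM !gcoef_elt.
by rewrite -[in RHS](inj_eq (mulgI x)) mulKVg.
Qed.

Lemma gelt1 : gelt R 1%g = 1 :> gring R G. Proof. by []. Qed.

Lemma geltX x k : gelt R (x ^+ k)%g = gelt R x ^+ k :> gring R G.
Proof.
by elim: k => [|k IHk]; rewrite ?expr0 ?expg0 // exprS expgS geltM IHk.
Qed.

Lemma gring_sumE a : a = \sum_x gconst G (gcoef a x) * gelt R x.
Proof.
apply: gringP => y; rewrite gcoef_sum (bigD1 y) //= big1 => [|x /negbTE xy].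
  by rewrite gcoef_constM gcoef_elt eqxx mulr1 addr0.
by rewrite gcoef_constM gcoef_elt eq_sym xy mulr0.
Qed.

Lemma gconst0 : gconst G (0 : R) = 0.
Proof. by apply: gringP => x; rewrite gcoef0 /gcoef ffunE; case: ifP. Qed.

Lemma gconst_sum (J : Type) (r : seq J) (P : pred J) (F : J -> R) :
  gconst G (\sum_(j <- r | P j) F j) = \sum_(j <- r | P j) gconst G (F j).
Proof.
apply: gringP => x; rewrite gcoef_sum /gcoef ffunE.
under [RHS]eq_bigr => j _ do rewrite ffunE.
by case: ifP => // _; rewrite big1.
Qed.

Lemma gelt_gsum H h : h \in H -> gelt R h * gsum R H = gsum R H.
Proof.
move=> hH; rewrite /gsum mulr_sumr [RHS](reindex_inj (mulgI h)).
by apply: eq_big => x; rewrite ?groupMl // geltM.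
Qed.

Lemma gsum_gsub1 H h : h \in H -> gsum R H * gsub1 h = 0.
Proof. by move=> hH; rewrite mulrBr mulr1 mulrC gelt_gsum ?subrr. Qed.

Lemma gsumM_sub H K : H \subset K -> gsum R H * gsum R K = #|H|%:R * gsum R K.
Proof.
move=> HK; rewrite {1}/gsum mulr_suml -sumr_const mulr_suml.
apply: eq_bigr => h hH; rewrite mul1r gelt_gsum //.
exact: (fintype.subsetP HK).
Qed.

Lemma gsum_dprod H K (L : {group G}) :
  (H \x K = L)%g -> gsum R L = gsum R H * gsum R K.
Proof.
move=> /mulgmP/misomP[mulgm_morphic /isomP[mulgm_inj <-]].
rewrite /gsum mulr_suml.
under [RHS]eq_bigr => x _ do rewrite mulr_sumr.
rewrite pair_big morphimEdom big_imset; last exact/injmP.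
by apply: eq_big => [[x y]|[x y] _]; rewrite ?inE //= geltM.
Qed.

Lemma gsum_bigdprod s (Is : 'I_s -> {group G}) (I : {group G}) :
  \big[dprod/1%g]_(l < s) (Is l : {set G}) = I ->
  gsum R I = \prod_l gsum R (Is l).
Proof.
elim: s Is I => [|s IHs] Is I.
  by rewrite !big_ord0 => <-; rewrite /gsum big_set1.
rewrite !big_ord_recl /= => def; have [[_ K _ K_E] _ _ _] := dprodP def.
by rewrite -(IHs _ K K_E); apply: gsum_dprod; rewrite -K_E.
Qed.

Lemma gsub1_gen_group_set (T : set (gring R G)) :
  group_set [set h : G | `[< ideal_gen T (gsub1 h) >]]%SET.
Proof.
apply/group_setP; split=> [|x y].
  rewrite finset.in_set; apply/asboolP; rewrite /gsub1 gelt1 subrr.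
  exact: ideal_gen0.
rewrite !finset.in_set => /asboolP Tx /asboolP Ty; apply/asboolP.
have -> : gsub1 (x * y)%g = gelt R x * gsub1 y + gsub1 x.
  by rewrite /gsub1 geltM mulrBr mulr1 addrA subrK.
by apply: ideal_genD => //; apply: ideal_genMl.
Qed.

Lemma gsub1_gen (T : set (gring R G)) (A : {set G}) :
  (forall x, x \in A -> ideal_gen T (gsub1 x)) ->
  forall x, x \in <<A>>%g -> ideal_gen T (gsub1 x).
Proof.
move=> TA x; have sub : <<A>>%g \subset Group (gsub1_gen_group_set T).
  rewrite gen_subG; apply/fintype.subsetP => y /TA Ty; rewrite finset.in_set.
  exact/asboolP.
by move=> /(fintype.subsetP sub); rewrite finset.in_set => /asboolP.
Qed.

Lemma fixed_cycle x a : gelt R x * a = a ->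
  forall h, h \in <[x]>%g -> gelt R h * a = a.
Proof.
move=> xa _ /cycleP[k ->]; elim: k => [|k IHk]; first by rewrite gelt1 mul1r.
by rewrite expgS geltM -mulrA IHk.
Qed.

End Norms.

Section Projection.
Variables (R : comNzRingType) (G : finAbGroupType) (H : {group G}).
Implicit Types (a : gring R G) (b : gring R (coset_of H)).

Lemma gproj_gelt x : gproj H (gelt R x) = gelt R (coset H x).
Proof.
apply: gringP => y; rewrite gprojE gcoef_elt.
have [->|yx] := eqVneq y (coset H x).
  rewrite (bigD1 x) //= big1 ?addr0 => [|z /andP[_ /negbTE zx]].
    by rewrite gcoef_elt eqxx.
  by rewrite gcoef_elt zx.
rewrite big1 // => z /eqP zy; rewrite gcoef_elt; case: eqP => // zx.
by rewrite -zy zx eqxx in yx.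
Qed.

Lemma gproj_gconst (c : R) : gproj H (gconst G c) = gconst (coset_of H) c.
Proof.
apply: gringP => y; rewrite gprojE [RHS]/gcoef ffunE.
under eq_bigr => x _ do rewrite /gcoef ffunE.
rewrite -big_mkcondr; have [->|y1] := eqVneq y 1%g.
  rewrite (big_pred1 1%g) // => x /=.
  by have [->|_] := eqVneq x 1%g; rewrite ?andbF // morph1 eqxx.
rewrite big_pred0 // => x; have [->|_] := eqVneq x 1%g; last exact: andbF.
by rewrite morph1 eq_sym (negbTE y1).
Qed.

Definition gsection b : gring R G :=
  \sum_y gconst G (gcoef b y) * gelt R (fingroup.repr y).

Lemma gsectionK : cancel gsection (gproj H).
Proof.
move=> b; rewrite /gsection rmorph_sum [RHS]gring_sumE; apply: eq_bigr => y _.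
by rewrite rmorphM /= gproj_gconst gproj_gelt coset_reprK.
Qed.

Lemma coset_eqE (x y : G) : (coset H x == coset H y) = (x * y^-1 \in H)%g.
Proof.
rewrite -mem_rcoset; apply/eqP/idP => /rcoset_kercosetP; apply;
  exact: abg_norm.
Qed.

Lemma coset_repr_mem x : (x * (fingroup.repr (coset H x))^-1 \in H)%g.
Proof. by rewrite -coset_eqE coset_reprK. Qed.

Lemma gcoef_gsumM a x : gcoef (gsum R H * a) x = gcoef (gproj H a) (coset H x).
Proof.
rewrite gprojE /gsum mulr_suml gcoef_sum.
under eq_bigr => h _ do rewrite gcoef_eltM.
rewrite [RHS](reindex_inj (mulIg x)) [RHS](reindex_inj invg_inj).
by apply: eq_bigl => h; rewrite coset_eqE mulgK groupV.
Qed.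

Lemma gproj_eq0 a : gproj H a = 0 <-> gsum R H * a = 0.
Proof.
split=> Ha; first by apply: gringP => x; rewrite gcoef_gsumM Ha !gcoef0.
apply: gringP => y; have [x _ ->] := cosetP y.
by rewrite -gcoef_gsumM Ha !gcoef0.
Qed.

Lemma gsum_divides a : (forall h, h \in H -> gelt R h * a = a) ->
  exists c, a = gsum R H * c.
Proof.
move=> Ha; pose b : gring R (coset_of H) :=
  [ffun y : coset_of H => gcoef a (fingroup.repr y)].
exists (gsection b).
apply: gringP => x; rewrite gcoef_gsumM gsectionK [RHS]/gcoef ffunE.
by rewrite -[in LHS](Ha _ (coset_repr_mem x)) gcoef_eltM invMg invgK mulgKV.
Qed.

Lemma gproj_ker_gen a :
  gproj H a = 0 -> ideal_gen [set gsub1 R h | h in [set` H]] a.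
Proof.
move=> Ha; pose r x := fingroup.repr (coset H x).
have -> : a = \sum_x gconst G (gcoef a x) * (gelt R x - gelt R (r x)).
  under eq_bigr => x _ do rewrite mulrBr.
  rewrite sumrB -gring_sumE (partition_big (coset H) predT) //= -[LHS]subr0.
  congr (_ - _); rewrite big1 // => y _.
  rewrite (eq_bigr (fun x => gconst G (gcoef a x) * gelt R (fingroup.repr y))).
    by rewrite -mulr_suml -gconst_sum -gprojE Ha gcoef0 gconst0 mul0r.
  by move=> x /eqP <-.
apply: ideal_gen_sum => x _; apply: ideal_genMl.
have -> : gelt R x - gelt R (r x) = gelt R (r x) * gsub1 R (x * (r x)^-1)%g.
  by rewrite mulrBr mulr1 -geltM abgC mulgKV.
apply/ideal_genMl/ideal_gen_incl; exists (x * (r x)^-1)%g => //.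
exact: coset_repr_mem.
Qed.

End Projection.

(** * Syzygies *)

Definition koszul_syzygies (R : comNzRingType) s (nu t : 'I_s -> R) : Prop :=
  forall a : 'rV[R]_s, \sum_l a 0 l * t l = 0 -> exists C S,
    alternating S /\ a = C *m diag_mx (\row_j nu j) + (\row_k t k) *m S.

Lemma row_split (T : Type) m n (f : 'I_(m + n) -> T) :
  \row_i f i = row_mx (\row_i f (lshift n i)) (\row_i f (rshift m i)).
Proof.
apply/rowP => i.
by case: (split_ordP i) => j ->; rewrite ?row_mxEl ?row_mxEr !mxE.
Qed.

Lemma block_alternating (R : comNzRingType) s (b : 'rV[R]_s) (S : 'M[R]_s) :
  alternating S -> alternating (block_mx (0 : 'M_1) b (- b^T) S).
Proof.
move=> [St Sii]; split=> [|i].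
  by rewrite tr_block_mx St trmx0 linearN /= trmxK opp_block_mx oppr0 opprK.
by case: (split_ordP i) => j ->; rewrite ?block_mxEul ?block_mxEdr ?mxE.
Qed.

(* The first coefficient of a relation is determined modulo the ideal of the
   other [t l], which is the annihilator of n. *)
Lemma koszul_syzygies_cons (R : comNzRingType) s (nu t : 'I_(1 + s) -> R)
    (n : R) :
  let nu0 := nu (lshift s 0) in let t0 := t (lshift s 0) in
  let nu' := nu \o @rshift 1 s in let t' := t \o @rshift 1 s in
  nu0 * t0 = 0 -> (forall l, n * t' l = 0) ->
  (forall a, n * a = 0 -> ideal_gen (range t') a) ->
  (forall a, n * a * t0 = 0 -> exists c, n * a = n * (c * nu0)) ->
  koszul_syzygies nu' t' -> koszul_syzygies nu t.
Proof.
move=> nu0 t0 nu' t' nu_t0 nt' n_ker n_t0 syz a.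
rewrite big_split_ord big_ord1 => rel; set a0 := a 0 (lshift s 0) in rel.
have a'E l : a 0 (rshift 1 l) = rsubmx a 0 l by rewrite mxE.
have [|c0 c0E] := n_t0 a0.
  rewrite -mulrA -[RHS](mulr0 n) -rel mulrDr [X in _ = _ + X]mulr_sumr.
  by rewrite big1 ?addr0 // => l _; rewrite mulrCA nt' mulr0.
have /n_ker/ideal_gen_rangeP[b bE] : n * (c0 * nu0 - a0) = 0.
  by rewrite mulrBr c0E subrr.
have [|C [S [Salt a'CS]]] := syz (rsubmx a - t0 *: \row_l b l).
  pose rel_term l := a 0 (rshift 1 l) * t' l - t0 * (b l * t' l).
  rewrite (eq_bigr rel_term) => [|l _].
    rewrite sumrB -mulr_sumr -bE mulrBr mulrCA [t0 * nu0]mulrC nu_t0.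
    by rewrite mulr0 sub0r opprK addrC mulrC.
  by rewrite /rel_term [_ 0 l]mxE -a'E !mxE mulrBl mulrA.
exists (row_mx (const_mx c0) C).
exists (block_mx (0 : 'M_1) (\row_l b l) (- (\row_l b l)^T) S).
split; first exact: block_alternating.
rewrite -[a in LHS]hsubmxK !row_split diag_mx_row !mul_row_block add_row_mx.
rewrite !(mulmx0, addr0, add0r); congr row_mx; last first.
  rewrite addrCA -[LHS](subrK (t0 *: \row_l b l)) a'CS [RHS]addrC.
  by congr (_ + _); apply/rowP => l; rewrite !mxE big_ord1 !mxE.
apply/rowP => i; rewrite ord1 mul_mx_diag mulmxN !mxE -/a0.
rewrite -[LHS](subKr (c0 * nu0)) bE; congr (_ - _).
by apply: eq_bigr => l _; rewrite !mxE mulrC.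
Qed.

Section DirectDecomposition.
Variables (R : comNzRingType) (G : finAbGroupType).

Section Generators.
Variables (s : nat) (Is : 'I_s -> {group G}) (I : {group G}).
Variable sigma : 'I_s -> G.
Hypothesis Is_sigma : forall l, Is l = <[sigma l]>%g :> {set G}.
Hypothesis Is_prod : \big[dprod/1%g]_(l < s) (Is l : {set G}) = I.

Lemma mem_bigdprod_gen l : sigma l \in I.
Proof.
rewrite -(bigdprodWY Is_prod) mem_gen //; apply/finset.bigcupP; exists l => //.
by rewrite Is_sigma cycle_id.
Qed.

Lemma gsub1_bigdprod h : h \in I ->
  ideal_gen (range (fun l => gsub1 R (sigma l))) (gsub1 R h).
Proof.
rewrite -(bigdprodWY Is_prod); apply: gsub1_gen => x /finset.bigcupP[l _].
rewrite Is_sigma /cycle; apply: gsub1_gen => y /set1P->.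
by apply: ideal_gen_incl; exists l.
Qed.

Lemma gsum_ker_gen a : gsum R I * a = 0 ->
  ideal_gen (range (fun l => gsub1 R (sigma l))) a.
Proof.
move=> /gproj_eq0/gproj_ker_gen; apply: ideal_gen_sub => _ [h hI <-].
exact: gsub1_bigdprod.
Qed.

End Generators.

Lemma gring_koszul_syzygies s (Is : 'I_s -> {group G}) (I : {group G})
    (sigma : 'I_s -> G) :
  (forall l, Is l = <[sigma l]>%g :> {set G}) ->
  \big[dprod/1%g]_(l < s) (Is l : {set G}) = I ->
  koszul_syzygies (fun l => gsum R (Is l)) (fun l => gsub1 R (sigma l)).
Proof.
elim: s Is I sigma => [|s IHs] Is I sigma Is_sigma.
  move=> _ a _; exists 0, 0; split; last by rewrite [LHS]thinmx0 [RHS]thinmx0.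
  by split=> [|[]] //; rewrite trmx0 oppr0.
rewrite (@big_split_ord _ _ _ 1 s) big_ord1 => def.
have [[_ K _ K_E] _ _ _] := dprodP def; rewrite K_E in def.
have IsK_sigma l : Is (rshift 1 l) = <[sigma (rshift 1 l)]>%g :> {set G} by [].
apply: (@koszul_syzygies_cons _ s _ _ (gsum R K)) => [|l|a|a Ka|] /=.
- by apply: gsum_gsub1; rewrite Is_sigma cycle_id.
- exact/gsum_gsub1/(mem_bigdprod_gen IsK_sigma K_E).
- exact: (gsum_ker_gen IsK_sigma K_E).
- have Ka_fixed :
      gelt R (sigma (lshift s (0 : 'I_1))) * (gsum R K * a) = gsum R K * a.
    apply/eqP; rewrite -subr_eq0 -{2}[gsum R K * a]mul1r -mulrBl mulrC.
    exact/eqP.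
  have [|c ->] := @gsum_divides _ _ I (gsum R K * a).
    move=> h; have /dprodP[_ <- _ _] := def => /mulsgP[x y].
    rewrite Is_sigma => /(fixed_cycle Ka_fixed) Lx Ky ->.
    by rewrite abgC geltM -mulrA Lx mulrA gelt_gsum.
  by exists c; rewrite (gsum_dprod R def); ring.
exact: IHs IsK_sigma K_E.
Qed.

End DirectDecomposition.

(** * Cyclic quotients *)

Section QuotientModule.
Variables (R : comNzRingType) (M : lmodType R) (S : set M).

Lemma lquot_pi_is_linear : linear (@lquot_pi R M S).
Proof. by move=> a x y; rewrite lquot_piD -lquot_piZ. Qed.

HB.instance Definition _ := GRing.isLinear.Build R M (lquot S) *:%R
  (@lquot_pi R M S) lquot_pi_is_linear.

Lemma lquot_pi_eq0 x : lquot_pi S x = 0 <-> lspan S x.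
Proof.
rewrite -(linear0 (@lquot_pi R M S)); split=> [E|/lspanbP Sx].
  by apply/lspanbP; rewrite -[x]subr0 Quotient.idealrBE; apply/eqP.
by apply/eqP; rewrite -Quotient.idealrBE subr0.
Qed.

End QuotientModule.

Section CyclicQuotient.
Variables (R : comNzRingType) (g : R).

Definition cyc_pi : {linear R^o -> cyc_quot g} := lquot_pi ([set g] : set R^o).

Lemma cyc_pi_surj u : exists a, cyc_pi a = u.
Proof. by have [a ->] := lquot_pi_surj u; exists a. Qed.

Lemma cyc_piM (a b : R) : cyc_pi (a * b) = a *: cyc_pi b.
Proof. exact: (linearZZ cyc_pi). Qed.

Lemma cyc_pi_eq0 (a : R) : cyc_pi a = 0 <-> exists b, a = b * g.
Proof. by rewrite -ideal_gen_set1; apply: lquot_pi_eq0. Qed.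

Lemma cyc_pi_gen1 : lspan (range (fun _ : 'I_1 => cyc_pi 1)) = setT.
Proof.
apply/seteqP; split=> // u _; have [a <-] := cyc_pi_surj u.
by rewrite -[a]mulr1 cyc_piM; apply/lspanZ/lspan_incl; exists ord0.
Qed.

Lemma Fitt_cyc_quot : Fitt (cyc_quot g) = ideal_gen [set g].
Proof.
rewrite (FittE cyc_pi_gen1); apply/seteqP; split.
  apply: fitt_of_sub => B xB; apply/ideal_gen_set1/cyc_pi_eq0.
  by rewrite det_mx11 -[B 0 0]mulr1 cyc_piM -[RHS](xB 0) lincomb_row big_ord1.
apply: ideal_gen_sub => _ ->.
have := @fitt_of_det _ _ 1 (fun=> cyc_pi 1) g%:M.
rewrite det_scalar1; apply=> i; rewrite lincomb_row big_ord1 ord1 mxE eqxx.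
rewrite -cyc_piM; apply/cyc_pi_eq0.
by exists 1; rewrite mulr1 mul1r.
Qed.

Lemma pd_le1_cyc_quot : GRing.lreg g -> pd_le1 (cyc_quot g).
Proof.
move=> g_reg; pose d : {linear 'rV[R]_1 -> 'rV[R]_1} := *:%R g.
pose e : {linear 'rV[R]_1 -> cyc_quot g} := lincomb (fun=> cyc_pi 1).
have eE v : e v = cyc_pi (v 0 0) by rewrite [LHS]big_ord1 -cyc_piM mulr1.
exists 'rV[R]_1, 'rV[R]_1, d, e; split; [exact: projective_row..|split].
- move=> u v /rowP duv; apply/rowP => j; apply: g_reg.
  by have := duv j; rewrite !mxE.
- by move=> u; have [a <-] := cyc_pi_surj u; exists a%:M; rewrite eE mxE eqxx.
move=> v; rewrite eE; split=> [/cyc_pi_eq0[c cE]|[u <-]].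
  by exists c%:M; apply/rowP => j; rewrite !mxE (ord1 j) cE mulrC.
by apply/cyc_pi_eq0; exists (u 0 0); rewrite mxE mulrC.
Qed.

Variables (s : nat) (nu t : 'I_s -> R) (n : R).
Hypothesis nu_t : forall l, nu l * t l = 0.
Hypothesis n_t : forall l, n * t l = 0.
Hypothesis n_ker : forall a, n * a = 0 -> ideal_gen (range t) a.
Hypothesis g_reg : GRing.lreg g.

Lemma cyc_quot_koszul_relation : koszul_syzygies nu t ->
  forall v, lincomb (cyc_pi \o t) v = 0 -> koszul_relation nu t g v.
Proof.
move=> syz v; rewrite -linear_lincomb => /cyc_pi_eq0[b bE].
have /n_ker/ideal_gen_rangeP[E EE] : n * b = 0.
  apply: g_reg; rewrite mulr0 mulrC -mulrA -bE mulr_sumr big1 // => j _.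
  by rewrite [_ *: _]mulrC mulrA n_t mul0r.
have [|C [S [Salt vCS]]] := syz (v - g *: \row_j E j).
  transitivity (lincomb (t : 'I_s -> R^o) v - b * g); last by rewrite bE subrr.
  rewrite EE mulr_suml -sumrB; apply: eq_bigr => j _.
  by rewrite !mxE mulrBl; congr (_ - _); ring.
by exists C, S, (\row_j E j); split=> //; rewrite -vCS subrK.
Qed.

Lemma fitt_of_cyc_quot_koszul : koszul_syzygies nu t ->
  fitt_of (cyc_pi \o t) = ideal_gen ([set \prod_j nu j] `|`
    [set g * a | a in Jideal_of nu (ideal_gen (range (oapp t g)))]).
Proof.
move=> syz; apply: fitt_of_koszul => // [l|l c|l|]; rewrite /= -?cyc_piM.
- by rewrite nu_t linear0.
- by rewrite mulrC.
- by apply/cyc_pi_eq0; exists (t l); rewrite mulrC.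
exact: cyc_quot_koszul_relation.
Qed.

End CyclicQuotient.

Section RestrictedCyclicQuotient.
Variables (R S : comNzRingType) (f : {rmorphism R -> S}) (g : R).

Definition restr_cyc_pi (a : R^o) : restr f (cyc_quot (f g)) :=
  cyc_pi (f g) (f a).

Lemma restr_cyc_pi_is_linear : linear restr_cyc_pi.
Proof.
move=> a x y; rewrite /restr_cyc_pi [a *: x]/(a * x) rmorphD rmorphM linearD.
by rewrite cyc_piM.
Qed.

HB.instance Definition _ := GRing.isLinear.Build R R^o
  (restr f (cyc_quot (f g))) *:%R restr_cyc_pi restr_cyc_pi_is_linear.

Hypothesis f_surj : forall b, exists a, f a = b.

Lemma restr_cyc_pi_eq0 a :
  restr_cyc_pi a = 0 <-> exists b c, f c = 0 /\ a = b * g + c.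
Proof.
rewrite cyc_pi_eq0; split=> [[b' abg]|[b [c [fc ->]]]].
  have [b fb] := f_surj b'; exists b, (a - b * g).
  rewrite [b * g + _]addrC subrK.
  by rewrite rmorphB rmorphM /= fb -abg subrr.
by exists (f b); rewrite rmorphD rmorphM /= fc addr0.
Qed.

Lemma restr_cyc_quot_cover s (t : 'I_s -> R) :
  (forall l, f (t l) = 0) -> (forall a, f a = 0 -> ideal_gen (range t) a) ->
  exists p : {linear cyc_quot g -> restr f (cyc_quot (f g))},
    (forall u, exists v, p v = u) /\
    forall v, p v = 0 <-> lspan (range (cyc_pi g \o t)) v.
Proof.
move=> ft t_gen.
have [p pE] : exists p : {linear cyc_quot g -> _},
    p \o cyc_pi g =1 restr_cyc_pi.
  apply: linear_descent => [|a /cyc_pi_eq0[b ->]]; first exact: cyc_pi_surj.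
  by apply/restr_cyc_pi_eq0; exists b, 0; rewrite rmorph0 addr0.
exists p; split=> [u|v].
  have [b <-] := cyc_pi_surj (u : cyc_quot (f g)); have [a <-] := f_surj b.
  by exists (cyc_pi g a); rewrite [LHS]pE.
split=> [|/lspan_rangeP[c ->]]; last first.
  rewrite linear_lincomb /lincomb big1 // => l _ /=.
  by rewrite [p _]pE /restr_cyc_pi ft linear0 scaler0.
have [a <-] := cyc_pi_surj v; rewrite [p _]pE => /restr_cyc_pi_eq0.
case=> [b [c [/t_gen/ideal_gen_rangeP[d ->] ->]]]; apply/lspan_rangeP.
exists (\row_l d l); rewrite linearD -[RHS]add0r; congr (_ + _).
  by apply/cyc_pi_eq0; exists b.
by rewrite linear_sum; apply: eq_bigr => l _; rewrite mxE cyc_piM.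
Qed.

End RestrictedCyclicQuotient.

Section Fitt1CyclicQuotient.
Variable G : finAbGroupType.
Local Notation ZG := (gring int G).
Local Notation QG := (gring rat G).

Lemma cyc_quot_finite (g w : ZG) N : (0 < N)%N -> w * g = N%:R ->
  finite_set [set: cyc_quot g].
Proof.
move=> N0 wg; suff -> : [set: cyc_quot g] = (cyc_pi g \o @gresidue G N) @` setT.
  exact/finite_image/finite_finset.
apply/seteqP; split=> // u _; have [a <-] := cyc_pi_surj u.
have [r [b ->]] := gresidue_decomp a N0; exists r => //=.
rewrite linearD -[LHS]addr0; congr (_ + _); apply/esym/cyc_pi_eq0.
by exists (w * b); rewrite -wg mulrAC.
Qed.

Lemma gratr_lreg (g : ZG) (u : QG) : u * gratr g = 1 -> GRing.lreg g.
Proof.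
move=> ug a b gab; apply: gratr_inj.
rewrite -[LHS]mul1r -[RHS]mul1r -ug -!mulrA.
by rewrite -!rmorphM /= gab.
Qed.

Lemma fracVM_principal (g : ZG) (u : QG) (S : set ZG) : u * gratr g = 1 ->
  fracM (fracV (@gratr G @` ideal_gen [set g])) (@gratr G @` ideal_gen S) =
  [set u * gratr a | a in ideal_gen S].
Proof.
move=> ug; apply/seteqP; split=> [|_ [a Sa <-]].
  apply: lspan_ind => [|c _ _ [v [_ [vg [a Sa <-] ->]]] [b Sb <-]].
    by exists 0; rewrite ?rmorph0 ?mulr0 //; apply: ideal_gen0.
  have [r _ rE] : range (@gratr G) (v * gratr g).
    by apply: vg; exists g => //; apply: ideal_gen_incl.
  exists (c * (r * a) + b).
    by apply: ideal_genD => //; do 2!apply: ideal_genMl.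
  rewrite -[c *: _]/(gratr c * _) !rmorphD !rmorphM /= rE mulrDr; congr (_ + _).
  transitivity (gratr c * (v * gratr a) * (u * gratr g)); first by ring.
  by rewrite ug mulr1.
apply: fracM_incl; last by exists a.
move=> _ [b /ideal_gen_set1[c ->] <-]; exists c => //.
by rewrite rmorphM mulrCA ug mulr1.
Qed.

Lemma Fitt1_restr_cyc_quot (S : comNzRingType) (f : {rmorphism ZG -> S})
    (g w : ZG) (u : QG) N s (t : 'I_s -> ZG) :
  (0 < N)%N -> w * g = N%:R -> u * gratr g = 1 ->
  (forall b, exists a, f a = b) -> (forall l, f (t l) = 0) ->
  (forall a, f a = 0 -> ideal_gen (range t) a) ->
  Fitt1 (restr f (cyc_quot (f g))) =
  [set u * gratr a | a in fitt_of (cyc_pi g \o t)].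
Proof.
move=> N0 wg ug f_surj ft t_gen.
have [p [p_surj p_ker]] := restr_cyc_quot_cover g f_surj ft t_gen.
have g_fin := cyc_quot_finite N0 wg.
have g_pd := pd_le1_cyc_quot (gratr_lreg ug).
have K_fin := finite_lkernel p g_fin.
rewrite (Fitt1E K_fin g_fin g_pd (short_exact_lkernel p_surj)).
have /fin_all_exists[k kE] l : exists y : lkernel p, val y = cyc_pi g (t l).
  by apply/lkernel_surj/p_ker/lspan_incl; exists l.
have kE' : val \o k = cyc_pi g \o t by apply: funext.
have kT : lspan (range k) = setT.
  apply/seteqP; split=> // y _; have /p_ker/lspan_rangeP[c yc] := lkernel_eq0 y.
  apply/lspan_rangeP; exists c; apply: val_inj.
  by rewrite yc (linear_lincomb (val : {linear lkernel p -> _})) kE'.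
rewrite Fitt_cyc_quot (FittE kT) -kE'.
rewrite (fitt_of_inj (i := (val : {linear lkernel p -> _})) k val_inj).
exact: fracVM_principal.
Qed.

End Fitt1CyclicQuotient.

(** * The module Z[G/I]/(g) *)

Section Frobenius.
Variables (G : finAbGroupType) (I : {group G}) (phit : G).
Local Notation ZG := (gring int G).
Local Notation QG := (gring rat G).
Local Notation nuI := (gsum int I).

(* A lift of [gA] to Z[G]; unlike [1 - phit^-1 + nu_I], it is regular. *)
Definition frob : ZG := 1 - gelt int phit^-1%g + #|I|%:R.

Lemma gproj_frob : gproj I frob = gA (coset I phit).
Proof.
rewrite rmorphD rmorphB rmorph1 rmorph_nat /= gproj_gelt.
by rewrite morphV ?abg_norm.
Qed.

Lemma frob_norm : exists w N, (0 < N)%N /\ w * frob = N%:R.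
Proof.
set y := phit^-1%g; set a := #|I|.+1; set m := #[y]%g.
have frobE : frob = a%:R - gelt int y by rewrite /frob /a -natr1; ring.
exists (\sum_(i < m) a%:R ^+ (m.-1 - i) * gelt int y ^+ i), (a ^ m - 1)%N.
split.
  by rewrite subn_gt0 -{1}(exp1n m) ltn_exp2r ?order_gt0 // ltnS cardG_gt0.
rewrite frobE mulrC -subrXX -geltX expg_order gelt1 natrB ?natrX //.
by rewrite expn_gt0.
Qed.

Lemma frob_inv : exists u : QG, u * gratr frob = 1.
Proof.
have [w [N [N0 wN]]] := frob_norm; exists (gconst G (N%:R^-1 : rat) * gratr w).
by rewrite -mulrA -rmorphM /= wN rmorph_nat gconst_natV.
Qed.

Lemma gratr_gelt x : gratr (gelt int x) = gelt rat x :> QG.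
Proof. by apply: gringP => y; rewrite gratrE !gcoef_elt; case: eqP. Qed.

Lemma gratr_gsum (H : {group G}) : gratr (gsum int H) = gsum rat H.
Proof. by rewrite rmorph_sum; apply: eq_bigr => x _; rewrite -gratr_gelt. Qed.

Lemma one_sub_idem_frob_norm : (1 - idem_frob I phit) * gratr nuI =
  gratr ((1 - gelt int phit^-1%g) * nuI).
Proof.
have norm_idem :
    gconst G (#|I|%:R^-1 : rat) * gsum rat I * gsum rat I = gsum rat I.
  by rewrite -mulrA gsumM_sub // mulrA gconst_natV ?mul1r ?cardG_gt0.
rewrite rmorphM rmorphB rmorph1 /= gratr_gelt gratr_gsum !mulrBl !mul1r.
by rewrite /idem_frob mulrAC norm_idem mulrC.
Qed.

Lemma elt_hE : elt_h I phit = 1 - idem_frob I phit + gratr nuI.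
Proof. by rewrite gratr_gsum. Qed.

Lemma elt_h_norm : elt_h I phit * gratr nuI = gratr (frob * nuI).
Proof.
rewrite elt_hE mulrDl one_sub_idem_frob_norm -rmorphM -rmorphD /= gsumM_sub //.
by rewrite -mulrDl.
Qed.

End Frobenius.

(** * Comparison of the ideals modulo the norm *)

Section FractionalIdeals.
Variable G : finAbGroupType.
Local Notation ZG := (gring int G).
Local Notation QG := (gring rat G).

Lemma image_ideal_gen (c : QG) (S : set ZG) :
  [set c * gratr a | a in ideal_gen S] = frac_gen [set c * gratr a | a in S].
Proof.
apply/seteqP; split=> [_ [a Sa <-]|].
  move: a Sa; apply: ideal_gen_ind => [|b a y Sa IHy].
    by rewrite rmorph0 mulr0; apply: lspan0.
  rewrite rmorphD rmorphM mulrDr mulrCA; apply: lspanD => //.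
  by apply: (@lspanZ ZG QG); apply: lspan_incl; exists a.
apply: lspan_ind => [|b _ _ [a Sa <-] [a' Sa' <-]].
  by exists 0; rewrite ?rmorph0 ?mulr0 //; apply: ideal_gen0.
exists (b * a + a').
  by apply: ideal_genD => //; apply/ideal_genMl/ideal_gen_incl.
by rewrite rmorphD rmorphM mulrDr mulrCA.
Qed.

Lemma frac_gen_sub_mod (n m r : ZG) (c c' : QG) (J J' : set ZG) :
  c = c' + gratr (m * n) -> c * gratr n = gratr (r * n) ->
  J `<=` ideal_gen (J' `|` [set n]) ->
  [set c * gratr a | a in J] `<=`
  frac_gen ([set gratr n] `|` [set c' * gratr a | a in J']).
Proof.
move=> cc' cn JJ' _ [a /JJ' J'a <-]; set T := [set _] `|` _.
have Tn b : frac_gen T (gratr (b * n)).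
  by rewrite rmorphM; apply: (@lspanZ ZG QG); apply: lspan_incl; left.
move: a J'a; apply: ideal_gen_ind => [|b a y J'a IHy].
  by rewrite rmorph0 mulr0; apply: lspan0.
rewrite rmorphD rmorphM mulrDr mulrCA; apply: lspanD => //.
apply: (@lspanZ ZG QG); case: J'a => [J'a|->]; last by rewrite cn; apply: Tn.
rewrite cc' mulrDl -rmorphM /= mulrAC; apply: lspanD; last exact: Tn.
by apply: lspan_incl; right; exists a.
Qed.

End FractionalIdeals.

Section AugmentationModulo.
Variables (G : finAbGroupType) (I D : {group G}) (phit : G).
Hypotheses (I_sub_D : I \subset D) (phit_D : phit \in D).
Hypothesis phit_gen : generator (D / I)%g (coset I phit).
Variables (s : nat) (Is : 'I_s -> {group G}) (sigma : 'I_s -> G).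
Hypothesis Is_sigma : forall l, Is l = <[sigma l]>%g :> {set G}.
Hypothesis Is_prod : \big[dprod/1%g]_(l < s) (Is l : {set G}) = I.

Local Notation ZG := (gring int G).
Local Notation nuI := (gsum int I).
Local Notation g := (frob I phit).
Let t l : ZG := gsub1 int (sigma l).
Let frob_ideal : set ZG := ideal_gen (range (oapp t g)).

Lemma group_quotient_generator : D \subset <<phit |: I>>%g.
Proof.
apply/fintype.subsetP => d dD.
have : coset I d \in (D / I)%g by rewrite mem_quotient.
rewrite (eqP phit_gen) => /cycleP[k]; rewrite -morphX ?abg_norm //.
move/eqP; rewrite coset_eqE => dI; rewrite -[d](mulgKV (phit ^+ k)%g).
by apply: groupM; [|apply: groupX]; rewrite mem_gen // !inE ?eqxx ?dI ?orbT.
Qed.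

Lemma aug_ker_frob_ideal : aug_ker D `<=` ideal_gen (frob_ideal `|` [set nuI]).
Proof.
move=> a /gproj_ker_gen; apply: ideal_gen_sub => _ [d dD <-].
have gsub1_I x : x \in I -> ideal_gen (frob_ideal `|` [set nuI]) (gsub1 int x).
  move=> xI; apply: ideal_gen_incl; left.
  have := gsub1_bigdprod int Is_sigma Is_prod xI.
  by apply: ideal_genS => _ [l _ <-]; exists (Some l).
apply: gsub1_gen (fintype.subsetP group_quotient_generator _ dD) => x.
rewrite !inE => /orP[/eqP->|]; last exact: gsub1_I.
have -> : gsub1 int phit =
    gelt int phit * (g - nuI + \sum_(y in I) gsub1 int y).
  have -> : g - nuI + \sum_(y in I) gsub1 int y = 1 - gelt int phit^-1%g.
    by rewrite sumrB sumr_const -/(gsum int I) /frob; ring.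
  by rewrite mulrBr mulr1 -geltM mulgV.
apply: ideal_genMl; apply: ideal_genD; last exact: ideal_gen_sum.
apply: ideal_genD; last by apply/ideal_genN/ideal_gen_incl; right.
by apply: ideal_gen_incl; left; apply: ideal_gen_incl; exists None.
Qed.

Lemma aug_ker_gsub1 x : x \in D -> aug_ker D (gsub1 int x).
Proof. by move=> xD; apply/gproj_eq0/gsum_gsub1. Qed.

Lemma frob_ideal_aug_ker : frob_ideal `<=` ideal_gen (aug_ker D `|` [set nuI]).
Proof.
apply: ideal_gen_sub => _ [[l|] _ <-] /=.
  apply: ideal_gen_incl; left; apply: aug_ker_gsub1.
  exact: (fintype.subsetP I_sub_D) (mem_bigdprod_gen Is_sigma Is_prod l).
rewrite -[g](subrK nuI); apply: ideal_genD; last first.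
  by apply: ideal_gen_incl; right.
apply: ideal_gen_incl; left; apply/gproj_eq0.
have -> : g - nuI = #|I|%:R - nuI - gsub1 int phit^-1%g.
  by rewrite /frob /gsub1; ring.
rewrite mulrBr gsum_gsub1 ?groupV // subr0 mulrBr [X in _ - X]mulrC.
by rewrite gsumM_sub // mulrC subrr.
Qed.

Lemma Fitt1_modA (u : gring rat G) : u * gratr g = 1 ->
  Fitt1 (modA (coset I phit)) = [set u * gratr a | a in ideal_gen ([set nuI] `|`
    [set g * a | a in Jideal_of (fun l => gsum int (Is l)) frob_ideal])].
Proof.
move=> ug; have [w [N [N0 wg]]] := frob_norm I phit.
have nuI_t l : nuI * t l = 0.
  exact/gsum_gsub1/(mem_bigdprod_gen Is_sigma Is_prod).
have nu_t l : gsum int (Is l) * t l = 0.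
  by apply: gsum_gsub1; rewrite Is_sigma cycle_id.
have t_gen a : nuI * a = 0 -> ideal_gen (range t) a.
  exact: (gsum_ker_gen Is_sigma Is_prod).
have syz : koszul_syzygies (fun l => gsum int (Is l)) t.
  exact: (gring_koszul_syzygies Is_sigma Is_prod).
rewrite /modA -gproj_frob (Fitt1_restr_cyc_quot (t := t) N0 wg ug) => [|b|l|a].
- rewrite (fitt_of_cyc_quot_koszul nu_t nuI_t t_gen (gratr_lreg ug) syz).
  by rewrite -(gsum_bigdprod int Is_prod).
- by exists (gsection b); apply: gsectionK.
- exact/gproj_eq0.
by move/gproj_eq0; apply: t_gen.
Qed.

Lemma elt_h_Fitt1_modA :
  [set elt_h I phit * x | x in Fitt1 (modA (coset I phit))] =
  frac_gen ([set gratr nuI] `|` [set elt_h I phit * gratr a | a in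
    Jideal_of (fun l => gsum int (Is l)) frob_ideal]).
Proof.
have [u ug] := frob_inv I phit; rewrite (Fitt1_modA ug) image_comp.
rewrite (_ : _ \o _ = fun a => elt_h I phit * u * gratr a); last first.
  by apply: funext => a /=; rewrite mulrA.
rewrite image_ideal_gen image_setU image_set1 image_comp.
congr (frac_gen (_ `|` _)).
  by rewrite mulrAC elt_h_norm rmorphM mulrAC [gratr g * u]mulrC ug mul1r.
apply: eq_imagel => a _ /=.
by rewrite rmorphM -mulrA (mulrA u) ug mul1r.
Qed.

End AugmentationModulo.

Theorem theorem1p4 (G : finAbGroupType) (I D : {group G})
    (I_sub_D : I \subset D)
    (phi : coset_of I) (phi_gen : generator (D / I)%g phi)
    (phit : G) (phit_D : phit \in D) (phit_lift : coset I phit = phi)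
    (s : nat) (Is : 'I_s -> {group G}) (Is_cyclic : forall l, cyclic (Is l))
    (Is_prod : \big[dprod/1%g]_(l < s) (Is l : {set G}) = (I : {set G})) :
  [set elt_h I phit * x | x in Fitt1 (modA phi)] =
  frac_gen ([set gsum rat I] `|`
            [set (1 - idem_frob I phit) * gratr x | x in Jideal D Is]).
Proof.
have /fin_all_exists[sigma Is_sigma] l := cyclicP (Is_cyclic l).
case: _ / phit_lift phi_gen => phi_gen.
rewrite (elt_h_Fitt1_modA phit Is_sigma Is_prod) -gratr_gsum.
apply/seteqP; split; apply: lspan_sub => x [->|].
- by apply: lspan_incl; left.
- apply: (frac_gen_sub_mod (m := 1) (r := frob I phit)).
  + by rewrite mul1r elt_hE.
  + exact: elt_h_norm.
  exact/Jideal_of_mod/(frob_ideal_aug_ker I_sub_D phit_D Is_sigma Is_prod).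
- by apply: lspan_incl; left.
apply: (frac_gen_sub_mod (m := -1) (r := 1 - gelt int phit^-1%g)).
- by rewrite mulN1r rmorphN elt_hE addrK.
- exact: one_sub_idem_frob_norm.
exact/Jideal_of_mod/(aug_ker_frob_ideal phi_gen Is_sigma Is_prod).
Qed.
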